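(* Let $\delta>0$ be fixed. Let $u_0\in L^2(\mathbb R)$ and let $u=u(x,t)$ be the global in time solution of the initial value problem for the ILW equation with $u(\cdot,0)=u_0$, such that $$u\in C(\mathbb R:L^2(\mathbb R))\cap L^\infty(\mathbb R:L^2(\mathbb R)).$$ Let $$0<b<\frac23\qquad\text{and}\qquad 0\le m<1-\frac32 b,$$ and, for $t>0$, let $B_{t^b}(t^m)=\{x\in\mathbb R:|x-t^m|<t^b\}$. Then $$\liminf_{t\to\infty}\int_{B_{t^b}(t^m)}u^2(x,t)\,dx=0 .$$
   Context: The Intermediate Long Wave (ILW) equation, with fixed parameter $\delta>0$, is $$\partial_t u+\mathcal T_\delta\partial_x^2u+\frac1\delta\partial_xu+u\,\partial_xu=0,\qquad (x,t)\in\mathbb R\times\mathbb R,$$ for a real-valued function $u=u(x,t)$, where $$\mathcal T_\delta f(x)=-\frac1{2\delta}\,\mathrm{p.v.}\int_{\mathbb R}\coth\Big(\frac{\pi(x-y)}{2\delta}\Big)f(y)\,dy .$$ Equivalently, with $\widehat f(\xi)=\int e^{-ix\xi}f(x)\,dx$, the operator $\mathcal T_\delta\partial_x^2+\frac1\delta\partial_x$ is the Fourier multiplier with symbol $-i\,\Omega_\delta(\xi)$, $\Omega_\delta(\xi)=\xi^2\coth(\delta\xi)-\xi/\delta$. The initial value problem is globally well posed in $H^s(\mathbb R)$ for every $s\ge0$ (Ifrim–Saut): for each $T>0$ the data-to-solution map on smooth ($H^\infty$) data extends uniquely to a continuous map $H^s(\mathbb R)\to C([-T,T]:H^s(\mathbb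 R))$; ''solution'' means the one given by this map. Solutions conserve the $L^2$-norm. *)

(* Defs.v *)
From HB Require Import structures.
From mathcomp Require Import all_boot all_order all_algebra.
From mathcomp Require Import all_classical all_reals all_analysis.

Set Implicit Arguments.
Unset Strict Implicit.
Unset Printing Implicit Defensive.

Import Order.TTheory GRing.Theory Num.Theory.
Import numFieldNormedType.Exports.

Local Open Scope classical_set_scope.
Local Open Scope ring_scope.

(* A space-time function is written u : R -> R -> R with the time variable
   first, so that u t is the function x |-> u(x,t).  Elements of L^2 are
   represented by functions, and equality in L^2 is equality a.e. *)

Definition L2 (R : realType) : {pred R -> R} :=
  Lfun (@lebesgue_measure R) 2%:E.
Arguments L2 : clear implicits.

Definition L2norm (R : realType) (f : R -> R) : \bar R :=
  ('N[@lebesgue_measure R]_2%:E[EFin \o f])%E.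

(* u \in C(I : L^2) *)
Definition L2_continuous (R : realType) (I : set R) (u : R -> R -> R) : Prop :=
  (forall t, I t -> u t \in L2 R) /\
  (forall t0, I t0 -> L2norm (u t \- u t0) @[t --> within I (nbhs t0)] --> 0%E).

(* u \in L^oo(R : L^2) *)
Definition L2_bounded (R : realType) (u : R -> R -> R) : Prop :=
  exists M : R, {ae @lebesgue_measure R, forall t, (L2norm (u t) <= M%:E)%E}.

(* H^oo(R), the intersection of all H^s(R): an element is represented by its
   smooth representative, all of whose derivatives are square integrable. *)
Definition Hinfty (R : realType) (f : R -> R) : Prop :=
  forall n : nat, (forall x, derivable (f^`(n)%classic) x 1) /\ f^`(n)%classic \in L2 R.

Definition coth (R : realType) (x : R) : R :=
  (expR x + expR (- x)) / (expR x - expR (- x)).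

(* (T_delta f)(x) exists and equals l.  The kernel is singular at y = x and
   tends to -1 and 1 at infinity, so for f = \partial_x^2 u with u in H^s the
   integral need not converge absolutely at infinity: the principal value is
   the joint limit of the integrals over p.1 < |x - y| < p.2. *)
Definition Tdelta_at (R : realType) (delta : R) (f : R -> R) (x l : R) : Prop :=
  (fun p : R * R => - (2 * delta)^-1 *
     (\int[@lebesgue_measure R]_(y in [set y | p.1 < `|x - y| < p.2])
        (coth (pi * (x - y) / (2 * delta)) * f y)))
  @ filter_prod 0^'+ (pinfty_nbhs R) --> l.

(* v is the solution in C(R : H^oo) with datum phi; the equation
   v_t + T_delta v_xx + v_x / delta + v v_x = 0 holds at every point. *)
Definition smooth_ILW_solution (R : realType) (delta : R) (phi : R -> R)
    (v : R -> R -> R) : Prop :=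
  [/\ forall t, Hinfty (v t),
      forall n : nat, L2_continuous setT (fun t => (v t)^`(n)%classic),
      v 0 = phi &
      forall t x,
        derivable (fun s => v s x) t 1 /\
        exists2 Tvxx : R, Tdelta_at delta ((v t)^`(2)%classic) x Tvxx &
          (fun s => v s x)^`()%classic t + Tvxx + delta^-1 * (v t)^`()%classic x
            + v t x * (v t)^`()%classic x = 0].

(* S is a continuous map L^2(R) -> C([-T,T] : L^2(R)) extending the
   data-to-solution map on H^oo data. *)
Definition ILW_data_to_solution (R : realType) (delta T : R)
    (S : (R -> R) -> R -> R -> R) : Prop :=
  [/\ forall phi, phi \in L2 R -> L2_continuous `[- T, T] (S phi),
      forall phi, phi \in L2 R -> forall e : R, 0 < e ->
        exists2 d : R, 0 < d & forall psi, psi \in L2 R ->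
          (L2norm (psi \- phi)%R < d%:E)%E ->
          forall t, t \in `[- T, T] ->
            (L2norm (S psi t \- S phi t)%R <= e%:E)%E &
      forall phi, Hinfty phi ->
        exists2 v, smooth_ILW_solution delta phi v &
          forall t, t \in `[- T, T] ->
            S phi t = v t %[ae @lebesgue_measure R]].

(* u is the global in time solution of the initial value problem with datum
   u0: on each [-T,T] it is the image of u0 under the extended map. *)
Definition ILW_solution (R : realType) (delta : R) (u0 : R -> R)
    (u : R -> R -> R) : Prop :=
  forall T : R, 0 < T ->
    exists2 S, ILW_data_to_solution delta T S &
      forall t, t \in `[- T, T] -> u t = S u0 t %[ae @lebesgue_measure R].

(* Main.v *)
Require Import Defs.
From HB Require Import structures.
From mathcomp Require Import all_boot all_order all_algebra.
From mathcomp Require Import all_classical all_reals all_analysis.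
From mathcomp Require Import measurable_realfun.
From mathcomp Require Import ring lra.

(** Suppose that the lower limit is positive: for some kap > 0 and all large t
    the ball of centre t^m and radius t^b carries L2-mass at least kap.  The
    contradiction comes from testing the equation against a weight that does
    not depend on time over the window [T, T + T^(th + b)], where
    th = 1 - max(m, b), and letting T tend to infinity.

    During this window the centre t^m moves by at most T^b and the radius stays
    below 2 T^b, so all the balls lie in the fixed interval of centre c = T^m
    and length lam = 6 T^b.  The weight is
      w(x) = step((x - c) / lam) - step((x - c) / lam1),
    where step is a bounded C3 function that increases on [-1, 1] and is
    constant outside, and lam1 = 6 T^q is a larger scale.  Subtracting the wide
    step makes w compactly supported, so that only compact intervals occur
    below.  For a smooth solution v put J(t) = int v(x, t) w(x) dx.  Then
      J' = 1/2 int v^2 w' - int (T_delta v_xx + v_x / delta) w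
    (virial_inequality), and the two terms behave as follows.
    - The narrow step contributes to w' a nonnegative slope that is at least
      (27/64) / lam on the interval containing the balls, and the wide one
      removes at most 1 / lam1.  So the quadratic term is bounded below by a
      multiple of kap / lam, up to a multiple of 1 / lam1
      (weight_d1_integral_ge).
    - The dispersive operator is integration against K = coth - 1, rescaled:
      the constant part of coth cancels v_x / delta exactly.  Since z K(z) is
      integrable, moving all derivatives to the weight bounds the second term
      by a constant times sup_s |int v(x + s) w_xxx(x) dx|, which is of order
      lam^(-5/2) by Cauchy-Schwarz (dispersion_weighted_le).  This is
      negligible against 1 / lam because b > 0.
    So J grows by an amount of order T^(th + b) / lam, that is T^th, while
    |J| is at most of order sqrt(lam1), that is T^(q/2), by Cauchy-Schwarz
    (weight_integral_le).  With q = b/2 + th both q > b and q/2 < th amount to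
    b/2 < th, which is where b < 2/3 and the condition on m enter, and T large
    gives the contradiction (local_mass_not_bounded_below).

    The solution at hand is only in L2, whereas the computation needs a smooth
    one.  H^oo is dense in L2 (Hinfty_dense), and by continuity of the
    data-to-solution map there are smooth solutions uniformly close to u in L2
    on [-2T, 2T] (smooth_approx).  The constants above depend on the
    smooth solution only through its L2-norm and its local mass, which are
    close to those of u; its higher norms occur only qualitatively, to justify
    differentiations and limits. *)

Set Implicit Arguments.
Unset Strict Implicit.
Unset Printing Implicit Defensive.

Import Order.TTheory GRing.Theory Num.Theory.
Import numFieldNormedType.Exports.

Local Open Scope classical_set_scope.
Local Open Scope ring_scope.

(** * Calculus on compact intervals *)

Section Calculus.
Context {R : realType}.
Notation mu := (@lebesgue_measure R).
Implicit Types (f g F G : R -> R) (a b c x : R).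

(** Derivatives are carried as explicit pairs of functions, which keeps the
    derivatives of weights and solutions in a usable closed form. *)
Definition is_deriv F f := forall x : R, is_derive x (1:R) F (f x).

Lemma is_deriv_cont F f : is_deriv F f -> continuous F.
Proof.
move=> Ff x; apply: differentiable_continuous.
by apply/derivable1_diffP; have [] := Ff x.
Qed.

Lemma is_deriv_derive1 F f : is_deriv F f -> F^`()%classic = f.
Proof.
by move=> Ff; apply/funext => x; rewrite derive1E; apply: (@derive_val _ _ _ _ _ _ _ (Ff x)).
Qed.

Lemma derivable_is_deriv F : (forall x, derivable F x 1) ->
  is_deriv F F^`()%classic.
Proof. by move=> dF x; split; [exact: dF|rewrite derive1E]. Qed.

Lemma is_derivM F f G g : is_deriv F f -> is_deriv G g ->
  is_deriv (fun x => F x * G x) (fun x => f x * G x + F x * g x).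
Proof.
move=> Ff Gg x; have := @is_deriveM _ _ F G x 1 _ _ (Ff x) (Gg x).
by move/(is_derive_eq); apply; rewrite /GRing.scale/= addrC; congr (_ + _); rewrite mulrC.
Qed.

Lemma is_deriv_shift F f c : is_deriv F f ->
  is_deriv (fun x => F (x + c)) (fun x => f (x + c)).
Proof.
move=> Ff x.
have h : is_derive x (1:R) (fun x : R => x + c) (1:R).
  by apply: is_derive_eq; rewrite addr0.
have := @is_derive1_comp R F (fun x : R => x + c) x _ _ (Ff (x + c)) h.
by rewrite mulr1.
Qed.

Lemma is_deriv_aff F f (k c : R) : is_deriv F f ->
  is_deriv (fun x => F (k * (x - c))) (fun x => k * f (k * (x - c))).
Proof.
move=> Ff x.
have h : is_derive x (1:R) (fun x : R => k * (x - c)) k.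
  by apply: is_derive_eq; rewrite /GRing.scale/= !(mulr0, mulr1, addr0, subr0, oppr0).
have := @is_derive1_comp R F (fun x : R => k * (x - c)) x _ _ (Ff (k * (x - c))) h.
by rewrite mulrC.
Qed.

Lemma continuous_derivable_oo F a b : continuous F -> (forall x, derivable F x 1) ->
  derivable_oo_LRcontinuous F a b.
Proof.
move=> cF dF; split => //.
- by apply: cvg_at_right_filter; exact: cF.
- by apply: cvg_at_left_filter; exact: cF.
Qed.

Lemma continuous_integrable_itv f a b : continuous f -> mu.-integrable `[a, b] (EFin \o f).
Proof.
move=> cf; apply: continuous_compact_integrable; first exact: segment_compact.
exact: continuous_subspaceT.
Qed.

Lemma Rintegral_FTC F f a b : is_deriv F f -> continuous f -> a <= b ->
  \int[mu]_(x in `[a, b]) f x = F b - F a.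
Proof.
move=> Ff cf; rewrite le_eqVlt => /predU1P[->|ab].
  by rewrite set_itv1 Rintegral_set1 subrr.
rewrite /Rintegral (@continuous_FTC2 R f F)//.
- exact: continuous_subspaceT.
- apply: continuous_derivable_oo; first exact: is_deriv_cont Ff.
  by move=> x; have [] := Ff x.
- by move=> x _; rewrite (is_deriv_derive1 Ff).
Qed.

Lemma continuous_mul f g : continuous f -> continuous g -> continuous (fun x => f x * g x).
Proof. by move=> cf cg x; apply: cvgM; [exact: cf|exact: cg]. Qed.

Lemma Rintegral_by_parts F f G g a b : is_deriv F f -> continuous f ->
  is_deriv G g -> continuous g -> a <= b ->
  \int[mu]_(x in `[a, b]) (F x * g x) =
  (F b * G b - F a * G a) - \int[mu]_(x in `[a, b]) (f x * G x).
Proof.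
move=> Ff cf Gg cg ab.
have cF := is_deriv_cont Ff; have cG := is_deriv_cont Gg.
have cfG := continuous_mul cf cG; have cFg := continuous_mul cF cg.
rewrite -(Rintegral_FTC (is_derivM Ff Gg))//; last by move=> x; apply: cvgD; [exact: cfG|exact: cFg].
by rewrite RintegralD//; [rewrite addrAC subrr add0r|exact: continuous_integrable_itv..].
Qed.

Lemma Rintegral_by_parts0 F f G g a b : is_deriv F f -> continuous f ->
  is_deriv G g -> continuous g -> a <= b -> G a = 0 -> G b = 0 ->
  \int[mu]_(x in `[a, b]) (f x * G x) = - \int[mu]_(x in `[a, b]) (F x * g x).
Proof.
move=> Ff cf Gg cg ab G0 G1.
by rewrite (Rintegral_by_parts Ff cf Gg cg ab) G0 G1 !mulr0 subrr sub0r opprK.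
Qed.

Lemma Rintegral_shift f a b c : continuous f -> a <= b ->
  \int[mu]_(y in `[a + c, b + c]) f y = \int[mu]_(x in `[a, b]) f (x + c).
Proof.
move=> cf ab; rewrite /Rintegral.
have dF : is_deriv (fun x : R => x + c) (cst 1).
  by move=> x; apply: is_derive_eq; rewrite addr0.
rewrite (@integration_by_substitution_increasing R (fun x => x + c) f a b)//.
- by congr fine; apply: eq_integral => x _ /=; rewrite (is_deriv_derive1 dF)/= mulr1.
- by move=> x y _ _ xy; rewrite ltrD2r.
- by rewrite (is_deriv_derive1 dF) => x _; exact: cvg_cst.
- by rewrite (is_deriv_derive1 dF); apply: is_cvg_cst.
- by rewrite (is_deriv_derive1 dF); apply: is_cvg_cst.
- apply: continuous_derivable_oo; first exact: is_deriv_cont dF.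
  by move=> x; have [] := dF x.
- exact: continuous_subspaceT.
Qed.

Lemma Rintegral_reflect f a b : continuous f -> a <= b ->
  \int[mu]_(y in `[- b, - a]) f y = \int[mu]_(x in `[a, b]) f (- x).
Proof.
move=> cf ab; rewrite /Rintegral integration_by_substitution_oppr//.
exact: continuous_subspaceT.
Qed.

Lemma Rintegral_support f a b p q : a <= p -> q <= b ->
  (forall x, ~~ (p <= x <= q) -> f x = 0) ->
  \int[mu]_(x in `[a, b]) f x = \int[mu]_(x in `[p, q]) f x.
Proof.
move=> ap qb f0; rewrite Rintegral_mkcond [RHS]Rintegral_mkcond.
apply: eq_Rintegral => x _; rewrite !patchE.
have E (u v : R) : (x \in `[u, v]%classic) = (u <= x <= v).
  by apply/idP/idP; rewrite inE/= in_itv.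
rewrite !E; case: (boolP (p <= x <= q)) => [/andP[px xq]|/f0 ->]; last by case: ifP.
by rewrite (le_trans ap px) (le_trans xq qb).
Qed.

Lemma Rintegral_cst_itv a b (k : R) : a <= b -> \int[mu]_(x in `[a, b]) k = k * (b - a).
Proof.
move=> ab; rewrite Rintegral_cst//= lebesgue_measure_itv/= lte_fin.
move: ab; rewrite le_eqVlt => /predU1P[->|->//]; by rewrite ltxx subrr.
Qed.

(** Cauchy-Schwarz against the constant 1, obtained by integrating the pointwise
    inequality 2 |f| <= k f^2 + 1/k for the optimal constant k. *)
Lemma Rintegral_norm_le_sqrt f a b (N : R) : a <= b -> 0 < N -> continuous f ->
  \int[mu]_(x in `[a, b]) (f x ^+ 2) <= N ^+ 2 ->
  \int[mu]_(x in `[a, b]) `|f x| <= Num.sqrt (b - a) * N.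
Proof.
move=> ab N0 cf fN.
have cn : continuous (fun x => `|f x|) by move=> x; apply: cvg_norm; exact: cf.
have cf2 : continuous (fun x => f x ^+ 2).
  exact: (continuous_mul cf cf).
move: ab; rewrite le_eqVlt => /predU1P[->|ab].
  by rewrite set_itv1 Rintegral_set1 mulr_ge0// ?sqrtr_ge0// ltW.
set s := Num.sqrt (b - a).
have s0 : 0 < s by rewrite sqrtr_gt0 subr_gt0.
have s2 : s ^+ 2 = b - a by rewrite sqr_sqrtr// subr_ge0 ltW.
(* The optimal constant: the ratio of the L2-norm of 1 to the bound for that of f. *)
pose k := s / N; have k0 : 0 < k by rewrite divr_gt0.
have i2 : mu.-integrable `[a, b] (EFin \o (fun x => k / 2 * f x ^+ 2)).
  by apply: continuous_integrable_itv => x; apply: cvgM; [exact: cvg_cst|exact: cf2].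
have ic (r : R) : mu.-integrable `[a, b] (EFin \o (fun x => r)).
  by apply: continuous_integrable_itv => x; exact: cvg_cst.
apply: (@le_trans _ _ (\int[mu]_(x in `[a, b]) (k / 2 * f x ^+ 2 + k^-1 / 2))).
  apply: le_Rintegral => //.
  - exact: continuous_integrable_itv.
  - apply: continuous_integrable_itv => x; apply: cvgD; last exact: cvg_cst.
    by apply: cvgM; [exact: cvg_cst|exact: cf2].
  - move=> x _; rewrite -subr_ge0.
    rewrite (_ : _ - _ = k / 2 * (`|f x| - k^-1) ^+ 2); last first.
      by rewrite sqrrB real_normK ?num_real//; field; rewrite gt_eqF.
    by rewrite mulr_ge0 ?sqr_ge0// ltW// divr_gt0.
rewrite RintegralD// RintegralZl//; last exact: continuous_integrable_itv.
rewrite Rintegral_cst_itv ?(ltW ab)//.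
apply: (@le_trans _ _ (k / 2 * N ^+ 2 + k^-1 / 2 * (b - a))).
  by rewrite lerD2r ler_wpM2l// ltW// divr_gt0.
rewrite -s2 /k le_eqVlt; apply/orP; left; apply/eqP; field.
by rewrite !gt_eqF.
Qed.

Lemma continuousT_comp (f g : R -> R) : continuous f -> continuous g ->
  continuous (fun x => f (g x)).
Proof. by move=> cf cg x; apply: continuous_comp; [exact: cg|exact: cf]. Qed.

Lemma continuous_addr (c : R) : continuous (fun x : R => x + c).
Proof. by move=> x; apply: cvgD; [exact: cvg_id|exact: cvg_cst]. Qed.

Lemma continuous_subl (c : R) : continuous (fun x : R => c - x).
Proof. by move=> x; apply: cvgB; [exact: cvg_cst|exact: cvg_id]. Qed.

Lemma continuous_aff (k c : R) (f : R -> R) : continuous f -> continuous (fun x => f (k * (x - c))).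
Proof.
move=> cf; apply: (continuousT_comp cf); apply: continuous_mul; first by move=> x; exact: cvg_cst.
exact: continuous_addr.
Qed.

(** The integrand may agree with different continuous functions on the two
    pieces; this is the case of coth (x - y) on either side of y = x. *)
Lemma Rintegral_setU_piecewise (A B : set R) (f f1 f2 : R -> R) :
  measurable A -> measurable B -> A `&` B = set0 ->
  mu.-integrable A (EFin \o f1) -> mu.-integrable B (EFin \o f2) ->
  {in A, f =1 f1} -> {in B, f =1 f2} ->
  \int[mu]_(x in A `|` B) f x = \int[mu]_(x in A) f1 x + \int[mu]_(x in B) f2 x.
Proof.
move=> mA mB AB i1 i2 e1 e2.
rewrite Rintegral_mkcond [in RHS]Rintegral_mkcond [X in _ + X]Rintegral_mkcond.
rewrite -RintegralD//.
- apply: eq_Rintegral => x _; rewrite !patchE in_setU.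
  case: (boolP (x \in A)) => xA; case: (boolP (x \in B)) => xB /=.
  + have : (A `&` B) x by split; [rewrite inE in xA|rewrite inE in xB].
    by rewrite AB.
  + by rewrite addr0 e1.
  + by rewrite add0r e2.
  + by rewrite addr0.
- have := iffLR (@integrable_mkcond _ _ _ mu A (EFin \o f1) mA) i1.
  by apply: eq_integrable => // x _; rewrite /= !patchE; case: ifPn.
- have := iffLR (@integrable_mkcond _ _ _ mu B (EFin \o f2) mB) i2.
  by apply: eq_integrable => // x _; rewrite /= !patchE; case: ifPn.
Qed.

Lemma Rintegral_itv_oo (f : R -> R) (a b : R) : continuous f ->
  \int[mu]_(x in `]a, b[) f x = \int[mu]_(x in `[a, b]) f x.
Proof.
move=> cf; have ic := continuous_integrable_itv a b cf.
have sub (A : set R) : measurable A -> A `<=` `[a, b] -> mu.-integrable A (EFin \o f).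
  by move=> mA Aab; exact: integrableS ic.
rewrite Rintegral_itv_bndo_bndc ?Rintegral_itv_obnd_cbnd//; apply: sub => // x /=;
  by rewrite !in_itv/= => /andP[] *; apply/andP; split; lra.
Qed.

Lemma is_deriv_scale (a k c : R) (F f : R -> R) : is_deriv F f ->
  is_deriv (fun x => a * F (k * (x - c))) (fun x => (a * k) * f (k * (x - c))).
Proof.
move=> Ff x; have dc : is_deriv (fun _ : R => a) (fun _ => 0) by move=> y; exact: is_derive_cst.
have := is_derivM dc (is_deriv_aff k c Ff) x.
by move/is_derive_eq; apply; ring.
Qed.

Lemma is_derivB (F f G g : R -> R) : is_deriv F f -> is_deriv G g ->
  is_deriv (fun x => F x - G x) (fun x => f x - g x).
Proof. by move=> Ff Gg x; apply: is_deriveB. Qed.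

Lemma mean_value_le (f f1 : R -> R) (B : R) : is_deriv f f1 -> (forall x, `|f1 x| <= B) ->
  forall x y, x <= y -> `|f y - f x| <= (y - x) * B.
Proof.
move=> ff1 fB x y xy.
have [||c _ ->] := @MVT_segment R f f1 x y xy.
- by move=> z _; exact: ff1.
- by apply: continuous_subspaceT; exact: is_deriv_cont ff1.
by rewrite normrM mulrC (ger0_norm (_ : 0 <= y - x)) ?subr_ge0// ler_wpM2l ?subr_ge0.
Qed.

(** Cauchy-Schwarz on the support [p, q] of a bounded factor: the length of
    that support, and not of [a, b], enters the bound. *)
Lemma Rintegral_mul_le (g h : R -> R) (a b p q C N : R) : a <= p -> p <= q -> q <= b ->
  continuous g -> continuous h -> 0 < N -> 
  (forall x, `|h x| <= C) -> (forall x, ~~ (p <= x <= q) -> h x = 0) ->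
  \int[mu]_(x in `[p, q]) (g x ^+ 2) <= N ^+ 2 ->
  `|\int[mu]_(x in `[a, b]) (g x * h x)| <= C * (Num.sqrt (q - p) * N).
Proof.
move=> ap pq qb cg ch N0 hC h0 gN.
have C0 : 0 <= C by rewrite (le_trans _ (hC 0)).
rewrite (@Rintegral_support _ a b p q ap qb); last by move=> x /h0 ->; rewrite mulr0.
have cgh := continuous_mul cg ch.
apply: (le_trans (le_normr_Rintegral _ _)) => //; first exact: continuous_integrable_itv.
have cn : continuous (fun x => `|g x|) by move=> x; apply: cvg_norm; exact: cg.
apply: (@le_trans _ _ (\int[mu]_(x in `[p, q]) (C * `|g x|))).
  apply: le_Rintegral => //.
  - by apply: continuous_integrable_itv => x; apply: cvg_norm; exact: cgh.
  - by apply: continuous_integrable_itv => x; apply: cvgM; [exact: cvg_cst|exact: cn].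
  - by move=> x _; rewrite normrM mulrC ler_wpM2r.
rewrite RintegralZl//; last exact: continuous_integrable_itv.
by rewrite ler_wpM2l// Rintegral_norm_le_sqrt.
Qed.

End Calculus.

(** * The space L2 of the line *)

Section L2.
Context {R : realType}.
Notation mu := (@lebesgue_measure R).
Implicit Types (f g : R -> R) (a b c x N : R).

Lemma L2_measurable f : f \in L2 R -> measurable_fun setT f.
Proof. by rewrite inE => /andP[]; rewrite inE. Qed.

Lemma L2norm_fin f : f \in L2 R -> (L2norm f < +oo)%E.
Proof. by rewrite inE => /andP[_]; rewrite inE. Qed.

Lemma L2_intro f : measurable_fun setT f -> (L2norm f < +oo)%E -> f \in L2 R.
Proof. by move=> mf nf; rewrite inE; apply/andP; split; rewrite inE. Qed.

Lemma L2norm_ge0 f : (0 <= L2norm f)%E.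
Proof. exact: Lnorm_ge0. Qed.

Lemma L2norm_sqr f : (L2norm f `^ 2 = \int[mu]_x (f x ^+ 2)%:E)%E.
Proof.
rewrite /L2norm powR_Lnorm//; apply: eq_integral => x _ /=.
by rewrite powR_mulrn// real_normK ?num_real.
Qed.

Lemma L2normE f : (L2norm f = (\int[mu]_x (f x ^+ 2)%:E) `^ 2^-1)%E.
Proof. by rewrite -L2norm_sqr -poweRrM mulfV// poweRe1// L2norm_ge0. Qed.

(** Turns bounds on the L2-norm into bounds on an integral, where monotonicity
    and domination arguments apply. *)
Lemma L2norm_leP f N : 0 <= N ->
  ((L2norm f <= N%:E) <-> (\int[mu]_x (f x ^+ 2)%:E <= (N ^+ 2)%:E))%E.
Proof.
move=> N0; rewrite -L2norm_sqr.
have -> : ((N ^+ 2)%:E = N%:E `^ 2)%E by rewrite poweR_EFin powR_mulrn.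
split=> h.
  by apply: gt0_ler_poweR => //; rewrite in_itv/= leey ?L2norm_ge0 ?lee_fin ?N0.
rewrite L2normE -L2norm_sqr.
have -> : (N%:E = (N%:E `^ 2) `^ 2^-1)%E by rewrite -poweRrM mulfV// poweRe1.
by apply: gt0_ler_poweR; rewrite ?in_itv/= ?leey ?poweR_ge0 ?lee_fin ?powR_ge0 ?invr_ge0// ?ler0n.
Qed.

Lemma L2norm_integral (D : set R) f N : measurable D -> measurable_fun setT f ->
  (L2norm f <= N%:E)%E -> (\int[mu]_(x in D) (f x ^+ 2)%:E <= (N ^+ 2)%:E)%E.
Proof.
move=> mD mf fN.
have N0 : 0 <= N by rewrite -lee_fin (le_trans (L2norm_ge0 f)).
apply: le_trans ((L2norm_leP f N0).1 fN).
apply: ge0_subset_integral => //.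
- by apply/measurable_EFinP; apply: measurable_funX.
- by move=> x _; rewrite lee_fin sqr_ge0.
Qed.

Lemma EFin_Rintegral f a b : continuous f ->
  (\int[mu]_(x in `[a, b]) (f x))%:E = (\int[mu]_(x in `[a, b]) (f x)%:E)%E.
Proof.
move=> cf; rewrite /Rintegral fineK//; apply: integrable_fin_num => //.
exact: continuous_integrable_itv.
Qed.

Lemma L2norm_Rintegral f a b N : continuous f -> (L2norm f <= N%:E)%E ->
  \int[mu]_(x in `[a, b]) (f x ^+ 2) <= N ^+ 2.
Proof.
move=> cf fN; rewrite -lee_fin EFin_Rintegral; last exact: (continuous_mul cf cf).
by apply: L2norm_integral => //; exact: continuous_measurable_fun.
Qed.

Lemma ae_imply_all (P Q : R -> Prop) : (forall x, P x -> Q x) ->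
  (\forall x \ae mu, P x) -> \forall x \ae mu, Q x.
Proof.
move=> PQ h; pose F := ae_filter_ringOfSetsType mu.
exact: (@filterS _ _ F _ _ _ h).
Qed.

Lemma L2norm_ae_eq (f g : R -> R) : f = g %[ae mu] -> measurable_fun setT f ->
  measurable_fun setT g -> L2norm f = L2norm g.
Proof.
move=> fg mf mg; rewrite !L2normE; congr poweR.
apply: ge0_ae_eq_integral => //.
1,2: by apply/measurable_EFinP; exact: measurable_funX.
1,2: by move=> x _; rewrite lee_fin sqr_ge0.
by apply: ae_imply_all fg => x fgx _ /=; rewrite fgx.
Qed.

Lemma L2normB f g : L2norm (f \- g)%R = L2norm (g \- f)%R.
Proof.
rewrite /L2norm -[LHS]oppe_Lnorm; congr Lnorm; apply/funext => x /=.
by congr EFin; rewrite opprB.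
Qed.

Lemma L2norm_triangle f g : measurable_fun setT f -> measurable_fun setT g ->
  (L2norm (f \+ g)%R <= L2norm f + L2norm g)%E.
Proof. by move=> mf mg; apply: minkowski_EFin => //; rewrite ler1n. Qed.

Lemma L2norm_le_near f g N e : measurable_fun setT f -> measurable_fun setT g ->
  (L2norm g <= N%:E)%E -> (L2norm (f \- g)%R <= e%:E)%E -> (L2norm f <= (N + e)%:E)%E.
Proof.
move=> mf mg gN fge.
have -> : f = ((f \- g) \+ g)%R by apply/funext => x /=; rewrite subrK.
apply: (le_trans (L2norm_triangle _ _)) => //; first exact: measurable_funB.
by rewrite EFinD addeC leeD.
Qed.

(** Integrating by parts against y - x on [x, x + 1] writes f (x + 1) as the
    integral of f plus that of (y - x) f'; Cauchy-Schwarz bounds both.  The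
    local form gives decay at infinity as well as a uniform bound. *)
Lemma sobolev_unit_itv f f1 (N0 N1 x : R) : is_deriv f f1 -> continuous f1 ->
  0 < N0 -> 0 < N1 ->
  \int[mu]_(y in `[x, x + 1]) (f y ^+ 2) <= N0 ^+ 2 ->
  \int[mu]_(y in `[x, x + 1]) (f1 y ^+ 2) <= N1 ^+ 2 ->
  `|f (x + 1)| <= N0 + N1.
Proof.
move=> ff1 cf1 N00 N10 fN0 fN1; have cf := is_deriv_cont ff1.
have xx1 : x <= x + 1 by rewrite lerDl.
have dG : is_deriv (fun y : R => y - x) (cst 1).
  by move=> y; apply: is_derive_eq; rewrite subr0.
have cG := is_deriv_cont dG.
have cp := continuous_mul cG cf1.
have c1 : continuous (cst 1 : R -> R) by move=> y; exact: cvg_cst.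
have := Rintegral_by_parts dG c1 ff1 cf1 xx1.
have e1 : x + 1 - x = 1 by rewrite addrAC subrr add0r.
rewrite e1 subrr mul1r mul0r subr0.
move=> /eqP; rewrite eq_sym subr_eq => /eqP ->.
under [X in _ + X]eq_Rintegral do rewrite /= mul1r.
rewrite addrC (le_trans (ler_normD _ _))// lerD//.
  apply: (le_trans (le_normr_Rintegral _ _)) => //; first exact: continuous_integrable_itv.
  by have := Rintegral_norm_le_sqrt xx1 N00 cf fN0; rewrite e1 sqrtr1 mul1r.
apply: (le_trans (le_normr_Rintegral _ _)) => //; first exact: continuous_integrable_itv.
have := Rintegral_norm_le_sqrt xx1 N10 cf1 fN1; rewrite e1 sqrtr1 mul1r.
apply: le_trans; apply: le_Rintegral => //.
- by apply: continuous_integrable_itv => y; apply: cvg_norm; exact: cp.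
- by apply: continuous_integrable_itv => y; apply: cvg_norm; exact: cf1.
- move=> y /=; rewrite in_itv/= => /andP[xy yx]; rewrite normrM ler_piMl//.
  by rewrite ger0_norm ?subr_ge0// lerBlDl.
Qed.

Lemma sobolev_sup f f1 (N0 N1 : R) : is_deriv f f1 -> continuous f1 ->
  0 < N0 -> 0 < N1 -> (L2norm f <= N0%:E)%E -> (L2norm f1 <= N1%:E)%E ->
  forall x, `|f x| <= N0 + N1.
Proof.
move=> ff1 cf1 N00 N10 fN0 fN1 x; rewrite -[x](subrK 1).
by apply: (sobolev_unit_itv ff1) => //; apply: L2norm_Rintegral => //; exact: is_deriv_cont ff1.
Qed.

(** Dominated convergence: the windows [u n, v n] leave every point. *)
Lemma L2_cvg0_window f (u v : nat -> R) : f \in L2 R -> continuous f ->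
  (forall x, \forall n \near \oo, ~~ (u n <= x <= v n)) ->
  (\int[mu]_(x in `[u n, v n]) (f x ^+ 2)) @[n --> \oo] --> 0.
Proof.
move=> fL cf uv.
have c2 : continuous (fun x => f x ^+ 2) by exact: (continuous_mul cf cf).
have m2 : measurable_fun setT (EFin \o (fun x => f x ^+ 2)).
  by apply/measurable_EFinP; exact: continuous_measurable_fun.
have ii : mu.-integrable setT (EFin \o (fun x => f x ^+ 2)) by exact: Lfun2_integrable_sqr.
pose F n (x : R) := ((EFin \o (fun x => f x ^+ 2)) \_ `[u n, v n]) x.
have [] := @dominated_convergence _ _ _ mu setT measurableT F (cst 0%E)
    (EFin \o (fun x => f x ^+ 2)) _ _ _ ii _.
- by move=> n; apply/(measurable_restrictT _ _).1 => //; exact: measurable_funTS.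
- exact: measurable_cst.
- apply: aeW => x _.
  apply: (@cvg_near_cst _ _ (0 : \bar R) (fun n => F n x)).
  near=> n; rewrite /F patchE; case: ifPn => //; rewrite inE/= in_itv/= => uxv.
  have : ~~ (u n <= x <= v n) by near: n; exact: uv.
  by rewrite uxv.
- apply: aeW => x n _; rewrite /F patchE; case: ifPn => _ /=.
    by rewrite ger0_norm ?sqr_ge0.
  by rewrite normr0 lee_fin sqr_ge0.
- move=> _ _; rewrite integral0.
move/fine_cvg; apply: cvg_trans; apply: near_eq_cvg; near=> n.
by rewrite /F /= -integral_mkcond.
Unshelve. all: by end_near. Qed.

Lemma Rintegral_itv_subset (f : R -> R) (a b p q : R) : a <= p -> q <= b ->
  continuous f -> (forall x, 0 <= f x) ->
  \int[mu]_(x in `[p, q]) f x <= \int[mu]_(x in `[a, b]) f x.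
Proof.
move=> ap qb cf f0; rewrite -lee_fin !EFin_Rintegral//.
apply: ge0_subset_integral => //.
- by apply: (measurable_int mu); exact: continuous_integrable_itv.
- by move=> x _; rewrite lee_fin.
- by move=> x /=; rewrite !in_itv/= => /andP[? ?]; apply/andP; split; lra.
Qed.

Lemma Rintegral_shift_sqr_le (g : R -> R) (p q s N : R) : continuous g -> p <= q ->
  (L2norm g <= N%:E)%E -> \int[mu]_(x in `[p, q]) (g (x + s) ^+ 2) <= N ^+ 2.
Proof.
move=> cg pq gN; have c2 : continuous (fun x => g x ^+ 2) by exact: (continuous_mul cg cg).
by rewrite -(Rintegral_shift s c2)//; exact: L2norm_Rintegral.
Qed.

End L2.

(** * Exchanging integrals, limits and derivatives *)

Section Exchange.
Context {R : realType}.
Notation mu := (@lebesgue_measure R).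

(** Fubini on a rectangle for real-valued integrals; the bound is required on
    the rectangle only, so F is extended by zero before Fubini applies. *)
Lemma Rintegral_exchange (F : R * R -> R) (a b c d M : R) :
  measurable_fun setT F ->
  (forall x z, a <= x <= b -> c <= z <= d -> `|F (x, z)| <= M) ->
  mu.-integrable `[a, b] (EFin \o (fun x => \int[mu]_(z in `[c, d]) F (x, z))) /\
  \int[mu]_(x in `[a, b]) \int[mu]_(z in `[c, d]) F (x, z) =
  \int[mu]_(z in `[c, d]) \int[mu]_(x in `[a, b]) F (x, z).
Proof.
move=> mF FM.
(* The zero extension G of F outside the rectangle is integrable on the plane. *)
pose D : set (R * R) := `[a, b] `*` `[c, d].
have mD : measurable (D : set (measurableTypeR R * measurableTypeR R)%type).
  by apply: measurableX.
have {}mF : measurable_fun [set: (measurableTypeR R * measurableTypeR R)%type] F by exact: mF.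
have finmu (u v : R) : (mu (`[u, v]%classic : set R) < +oo)%E.
  by rewrite lebesgue_measure_itv; case: ifPn => // _; rewrite -EFinB ltry.
pose G := (EFin \o F) \_ D.
have iG : (mu \x mu)%E.-integrable setT G.
  apply: (iffLR (@integrable_mkcond _ _ _ (mu \x mu)%E D (EFin \o F) mD)).
  apply: measurable_bounded_integrable => //.
  - rewrite [ltLHS](product_measure1E mu mu)//.
    by apply: lte_mul_pinfty; rewrite ?ge0_fin_numE//; exact: finmu.
  - exact: measurable_funTS.
  - exists M; split; first exact: num_real.
    move=> y My [x z] [/= xab zcd]; apply: (le_trans _ (ltW My)); apply: FM.
      by move: xab; rewrite in_itv.
    by move: zcd; rewrite in_itv.
have Gx x : (\int[mu]_z G (x, z) =
    ((fun x => \int[mu]_(z in `[c, d]) (F (x, z))%:E) \_ `[a, b]) x)%E.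
  rewrite patchE; case: ifPn => xab.
    rewrite [RHS]integral_mkcond; apply: eq_integral => z _; rewrite /G !patchE.
    rewrite (_ : ((x, z) \in D) = (z \in `[c, d]%classic))//.
    apply/idP/idP; rewrite !inE /D; first by case.
    by move=> zcd; split => //=; rewrite inE in xab.
  rewrite integral0_eq// => z _; rewrite /G patchE ifN//.
  by apply: contra xab; rewrite !inE => -[].
have Gz z : (\int[mu]_x G (x, z) =
    ((fun z => \int[mu]_(x in `[a, b]) (F (x, z))%:E) \_ `[c, d]) z)%E.
  rewrite patchE; case: ifPn => zcd.
    rewrite [RHS]integral_mkcond; apply: eq_integral => x _; rewrite /G !patchE.
    rewrite (_ : ((x, z) \in D) = (x \in `[a, b]%classic))//.
    apply/idP/idP; rewrite !inE /D; first by case.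
    by move=> xab; split => //=; rewrite inE in zcd.
  rewrite integral0_eq// => x _; rewrite /G patchE ifN//.
  by apply: contra zcd; rewrite !inE => -[].
have mFx x : measurable_fun [set: measurableTypeR R] (fun z : measurableTypeR R => F (x, z)).
  by apply: (measurableT_comp mF); exact: measurable_pair1.
have mFz z : measurable_fun [set: measurableTypeR R] (fun x : measurableTypeR R => F (x, z)).
  by apply: (measurableT_comp mF); exact: measurable_pair2.
have iFx x : a <= x <= b -> mu.-integrable `[c, d] (EFin \o (fun z => F (x, z))).
  move=> xab; apply: measurable_bounded_integrable; [by []|exact: finmu| |].
    exact: (measurable_funS measurableT (@subsetT _ _) (mFx x)).
  exists M; split; first exact: num_real.
  by move=> y My z /= zcd; apply: (le_trans _ (ltW My)); apply: FM => //; move: zcd; rewrite in_itv.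
have iFz z : c <= z <= d -> mu.-integrable `[a, b] (EFin \o (fun x => F (x, z))).
  move=> zcd; apply: measurable_bounded_integrable; [by []|exact: finmu| |].
    exact: (measurable_funS measurableT (@subsetT _ _) (mFz z)).
  exists M; split; first exact: num_real.
  by move=> y My x /= xab; apply: (le_trans _ (ltW My)); apply: FM => //; move: xab; rewrite in_itv.
split.
  apply/integrable_mkcond => //.
  apply: eq_integrable (integrable_fubini_F iG) => // x _.
  rewrite /fubini_F Gx !patchE; case: ifPn => //= xab.
  rewrite /Rintegral fineK//; apply: integrable_fin_num => //; apply: iFx.
  by move: xab; rewrite inE/= in_itv.
rewrite [LHS]/Rintegral [RHS]/Rintegral; congr fine.
transitivity (\int[mu]_x \int[mu]_z G (x, z))%E.
  rewrite integral_mkcond; apply: eq_integral => x _; rewrite Gx !patchE.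
  case: ifPn => // xab; rewrite /Rintegral fineK//.
  apply: integrable_fin_num => //; apply: iFx.
  by move: xab; rewrite inE/= in_itv.
rewrite Fubini// [RHS]integral_mkcond; apply: eq_integral => z _; rewrite Gz !patchE.
case: ifPn => // zcd; rewrite /Rintegral fineK//.
apply: integrable_fin_num => //; apply: iFz.
by move: zcd; rewrite inE/= in_itv.
Qed.

Lemma Rintegral_dominated (f_ : nat -> R -> R) (f : R -> R) (a b C : R) :
  (forall n, mu.-integrable `[a, b] (EFin \o f_ n)) ->
  (forall x, a <= x <= b -> f_ n x @[n --> \oo] --> f x) ->
  (forall n x, a <= x <= b -> `|f_ n x| <= C) ->
  mu.-integrable `[a, b] (EFin \o f) /\
  \int[mu]_(x in `[a, b]) f_ n x @[n --> \oo] --> \int[mu]_(x in `[a, b]) f x.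
Proof.
move=> i_ cvf fC.
have mD : measurable (`[a, b]%classic : set (measurableTypeR R)) by [].
have mf_ n : measurable_fun (`[a, b]%classic : set (measurableTypeR R)) (EFin \o f_ n).
  exact: (measurable_int mu).
have iC : mu.-integrable `[a, b] (EFin \o (cst C : R -> R)).
  by apply: continuous_integrable_itv => x; exact: cvg_cst.
have cvf' (x : measurableTypeR R) : `[a, b]%classic x -> (EFin \o f_ n) x @[n --> \oo] --> (EFin \o f) x.
  by rewrite /= in_itv/= => xab; apply: cvg_EFin; [exact: nearW|exact: cvf].
have mf : measurable_fun (`[a, b]%classic : set (measurableTypeR R)) (EFin \o f).
  exact: (emeasurable_fun_cvg (fun n => EFin \o f_ n)).
have [] := @dominated_convergence _ _ _ mu _ mD (fun n => EFin \o f_ n) (EFin \o f)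
  (EFin \o (cst C : R -> R)) mf_ mf _ iC _.
- by apply: aeW => x; exact: cvf'.
- by apply: aeW => x n; rewrite /= in_itv/= lee_fin; exact: fC.
move=> intf _ cvi; split => //.
rewrite /Rintegral; apply: fine_cvg; rewrite fineK//.
exact: integrable_fin_num.
Qed.

(** Differentiation under the integral: the shift acts on g alone, whose
    derivative is bounded, so the bound B1 Cw dominates. *)
Lemma is_deriv_conv (w g g1 : R -> R) (A Cw B1 : R) : continuous w -> is_deriv g g1 ->
  (forall x, `|w x| <= Cw) -> continuous g1 -> (forall x, `|g1 x| <= B1) ->
  is_deriv (fun s => \int[mu]_(x in `[- A, A]) (g (x + s) * w x))
           (fun s => \int[mu]_(x in `[- A, A]) (g1 (x + s) * w x)).
Proof.
move=> cw gg1 wC cg1 g1B s.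
have cg := is_deriv_cont gg1.
have dsx x : is_deriv (fun t => g (x + t) * w x) (fun t => g1 (x + t) * w x).
  move=> t; have h : is_derive t (1:R) (fun t : R => x + t) (1:R) by apply: is_derive_eq; ring.
  have d := @is_derive1_comp R g (fun t : R => x + t) t _ _ (gg1 (x + t)) h.
  rewrite mulr1 in d.
  have := is_deriveM d (is_derive_cst (w x) t (1:R)).
  by move/is_derive_eq; apply; rewrite /GRing.scale/=; ring.
have cs (f : R -> R) t : continuous f -> continuous (fun x => f (x + t) * w x).
  by move=> cf; apply: continuous_mul => //; apply: (continuousT_comp cf); exact: continuous_addr.
pose f (t x : R) := g (x + t) * w x.
have Is : [set` `]s - 1, s + 1[] s by rewrite /= in_itv/= ltrBlDr ltrDl ltr01.
have B10 : 0 <= B1 by rewrite (le_trans _ (g1B 0)).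
have Cw0 : 0 <= Cw by rewrite (le_trans _ (wC 0)).
have d1 t x : partial1of2 f t x = g1 (x + t) * w x.
  by rewrite /partial1of2 (is_deriv_derive1 (dsx x)).
have mD : measurable (`[- A, A]%classic : set (measurableTypeR R)) by [].
have hi t : [set` `]s - 1, s + 1[] t -> mu.-integrable `[- A, A] (EFin \o f t).
  by move=> _; apply: continuous_integrable_itv; exact: cs.
have hd t x : [set` `]s - 1, s + 1[] t -> `[- A, A]%classic x -> derivable (f ^~ x) t 1.
  by move=> _ _; have [] := dsx x t.
have hG : mu.-integrable `[- A, A] (EFin \o (cst (B1 * Cw) : R -> R)).
  by apply: continuous_integrable_itv => x; exact: cvg_cst.
have hb t x : [set` `]s - 1, s + 1[] t -> `[- A, A]%classic x ->
    `|partial1of2 f t x| <= (cst (B1 * Cw) : R -> R) x.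
  by move=> _ _; rewrite d1 normrM ler_pM.
have G0 (x : R) : 0 <= (cst (B1 * Cw) : R -> R) x by rewrite /= mulr_ge0.
split.
  exact: (@derivable_under_integral R _ _ mu f _ mD s _ _ Is hi hd _ G0 hG hb).
rewrite -derive1E.
rewrite (@differentiation_under_integral R _ _ mu f _ mD s _ _ Is hi hd _ G0 hG hb).
by apply: eq_Rintegral => x _; exact: d1.
Qed.

Lemma cvg_norm_le (u : nat -> R) (l C : R) : u n @[n --> \oo] --> l ->
  (forall n, `|u n| <= C) -> `|l| <= C.
Proof.
move=> ul uC; apply: (cvgr_to_le (cvg_norm ul)).
by apply: nearW => n; exact: uC.
Qed.

End Exchange.

(** * The kernel coth - 1 *)

Section Kernel.
Context {R : realType}.
Notation mu := (@lebesgue_measure R).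
Context (delta : R).
Context (delta0 : 0 < delta).
Implicit Types (f g w : R -> R) (p q x z : R).

Definition coth_rate : R := pi / (2 * delta).

Lemma coth_rate_gt0 : 0 < coth_rate.
Proof. by rewrite divr_gt0 ?pi_gt0// mulr_gt0. Qed.

Lemma coth_den_gt0 (y : R) : 0 < y -> 0 < expR y - expR (- y).
Proof. by move=> y0; rewrite subr_gt0 ltr_expR (lt_trans _ y0)// oppr_lt0. Qed.

Lemma cothN (y : R) : coth (- y) = - coth y.
Proof. by rewrite /coth opprK addrC -mulrN -invrN opprB. Qed.

Lemma coth_cont (y : R) : 0 < y -> {for y, continuous (@coth R)}.
Proof.
move=> y0; rewrite /coth; apply: cvgM.
  by apply: cvgD; [exact: continuous_expR | apply: continuous_comp; [exact: continuousN|exact: continuous_expR]].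
apply: cvgV; first by rewrite gt_eqF// coth_den_gt0.
by apply: cvgB; [exact: continuous_expR | apply: continuous_comp; [exact: continuousN|exact: continuous_expR]].
Qed.

(** This is 2 exp(-y) / (exp y - exp(-y)), and the denominator is at least y. *)
Lemma coth_sub1 (y : R) : 0 < y -> 0 <= coth y - 1 <= 2 * expR (- y) / y.
Proof.
move=> y0; have d0 := coth_den_gt0 y0.
have e : coth y - 1 = 2 * expR (- y) / (expR y - expR (- y)).
  by rewrite /coth; field; rewrite gt_eqF.
rewrite e; apply/andP; split.
  by rewrite divr_ge0 ?mulr_ge0 ?expR_ge0// ltW.
rewrite ler_pM2l ?mulr_gt0 ?expR_gt0// lef_pV2 ?posrE//.
have h1 := expR_ge1Dx y.
have h2 : expR (- y) <= 1 by rewrite expR_le1 oppr_le0 ltW.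
lra.
Qed.

(** The kernel K(z) = coth(a z) - 1, with a = coth_rate, made constant below p.
    It is unchanged on [p, +oo[ and continuous on the whole line, so that
    integrability on compact intervals follows from continuity. *)
Definition coth_kernel p z := coth (coth_rate * Num.max p z) - 1.

Lemma coth_kernel_cont p : 0 < p -> continuous (coth_kernel p).
Proof.
move=> p0 z; apply: cvgB; last exact: cvg_cst.
have m0 : 0 < coth_rate * Num.max p z by rewrite mulr_gt0 ?coth_rate_gt0// lt_max p0.
apply: (@continuous_comp _ _ _ (fun z => coth_rate * Num.max p z) (@coth R)); last exact: coth_cont.
apply: cvgM; first exact: cvg_cst.
by apply: continuous_max; [exact: cvg_cst|exact: cvg_id].
Qed.

Lemma coth_kernel_ge0 p z : 0 < p -> 0 <= coth_kernel p z.
Proof.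
move=> p0; have m0 : 0 < coth_rate * Num.max p z by rewrite mulr_gt0 ?coth_rate_gt0// lt_max p0.
by have /andP[] := coth_sub1 m0.
Qed.

(** The factor z compensates the singularity of the kernel at 0; the bound is
    uniform in the truncation p. *)
Lemma coth_kernel_bound p z : 0 < p -> p <= z -> z * coth_kernel p z <= 2 / coth_rate * expR (- coth_rate * z).
Proof.
move=> p0 pz; rewrite /coth_kernel (max_idPr pz).
have z0 : 0 < z by exact: lt_le_trans pz.
have k0 := coth_rate_gt0.
have /andP[_] := coth_sub1 (mulr_gt0 k0 z0).
rewrite -(ler_pM2l z0) => /le_trans; apply.
rewrite mulNr le_eqVlt; apply/orP; left; apply/eqP; field.
by rewrite !gt_eqF.
Qed.

(** The integral over ]0, +oo[ of the bound (2 / a) exp(-a z) for z K(z). *)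
Definition kernel_mass : R := 2 / coth_rate / coth_rate.

Lemma kernel_mass_gt0 : 0 < kernel_mass.
Proof. by rewrite /kernel_mass divr_gt0 ?coth_rate_gt0// divr_gt0 ?coth_rate_gt0. Qed.

Lemma Rintegral_exp_tail p q : p <= q ->
  \int[mu]_(z in `[p, q]) (2 / coth_rate * expR (- coth_rate * z)) = kernel_mass * (expR (- coth_rate * p) - expR (- coth_rate * q)).
Proof.
move=> pq; have k0 := coth_rate_gt0.
have dF : is_deriv (fun z => - kernel_mass * expR (- coth_rate * z)) (fun z => 2 / coth_rate * expR (- coth_rate * z)).
  move=> z; apply: is_derive_eq.
  by rewrite /GRing.scale/= /kernel_mass; field; rewrite gt_eqF.
rewrite (Rintegral_FTC dF)//; first by ring.
move=> z; apply: cvgM; first exact: cvg_cst.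
apply: (@continuous_comp _ _ _ (fun z => - coth_rate * z) expR); last exact: continuous_expR.
by apply: cvgM; [exact: cvg_cst|exact: cvg_id].
Qed.

(** A factor d vanishing linearly at 0 makes the integral converge absolutely,
    uniformly in the truncation. *)
Lemma coth_kernel_integral_le p q (d : R -> R) (B : R) : 0 < p -> p <= q -> 0 <= B ->
  mu.-integrable `[p, q] (EFin \o (fun z => coth_kernel p z * d z)) ->
  (forall z, 0 < z -> `|d z| <= 2 * z * B) ->
  `|\int[mu]_(z in `[p, q]) (coth_kernel p z * d z)| <= 2 * B * kernel_mass.
Proof.
move=> p0 pq B0 ik dB; have k0 := coth_rate_gt0.
have kC0 := kernel_mass_gt0.
have ce : continuous (fun z => 2 / coth_rate * expR (- coth_rate * z)).
  move=> z; apply: cvgM; first exact: cvg_cst.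
  apply: (@continuous_comp _ _ _ (fun z => - coth_rate * z) expR); last exact: continuous_expR.
  by apply: cvgM; [exact: cvg_cst|exact: cvg_id].
apply: (le_trans (le_normr_Rintegral _ _)) => //.
apply: (@le_trans _ _ (\int[mu]_(z in `[p, q]) (2 * B * (2 / coth_rate * expR (- coth_rate * z))))).
  apply: le_Rintegral => //.
  - exact: (integrable_norm ik).
  - by apply: continuous_integrable_itv => z; apply: cvgM; [exact: cvg_cst|exact: ce].
  - move=> z /=; rewrite in_itv/= => /andP[pz zq].
    have z0 : 0 < z by exact: lt_le_trans pz.
    rewrite normrM ger0_norm ?coth_kernel_ge0//.
    apply: (@le_trans _ _ (coth_kernel p z * (2 * z * B))).
      by rewrite ler_wpM2l ?coth_kernel_ge0 ?dB.
    rewrite (_ : _ * _ = 2 * B * (z * coth_kernel p z)); last by ring.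
    by rewrite ler_wpM2l ?mulr_ge0 ?coth_kernel_bound.
rewrite RintegralZl//; last exact: continuous_integrable_itv.
rewrite Rintegral_exp_tail// ler_wpM2l ?mulr_ge0// -[leRHS]mulr1 ler_pM2l//.
have h1 : expR (- coth_rate * p) <= 1 by rewrite expR_le1 mulNr oppr_le0 mulr_ge0 ?ltW.
by have := expR_ge0 (- coth_rate * q); lra.
Qed.

End Kernel.

(** * Truncated principal values *)

Section Trunc.
Context {R : realType}.
Notation mu := (@lebesgue_measure R).

Context (delta : R).
Context (delta0 : 0 < delta).

Lemma truncation_set (p q x : R) : 0 < p ->
  [set y | p < `|x - y| < q] = `]x - q, x - p[ `|` `]x + p, x + q[.
Proof.
move=> p0; apply/seteqP; split => y /=.
  move=> /andP[]; rewrite lter_norml ltr_normr => /orP[h1|h1] /andP[h2 h3].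
    by left; rewrite in_itv/=; apply/andP; split; lra.
  by right; rewrite in_itv/=; apply/andP; split; lra.
case; rewrite in_itv/= => /andP[h1 h2].
  by rewrite gtr0_norm; [apply/andP; split|]; lra.
by rewrite ltr0_norm; [apply/andP; split|]; lra.
Qed.

(** The two halves of the truncated principal value are folded onto z > 0;
    coth being odd, the symmetric difference of f appears. *)
Lemma truncated_Tdelta (p q x : R) (f : R -> R) : 0 < p -> p <= q -> continuous f ->
  \int[mu]_(y in [set y | p < `|x - y| < q]) (coth (pi * (x - y) / (2 * delta)) * f y) =
  \int[mu]_(z in `[p, q]) ((coth_kernel delta p z + 1) * (f (x - z) - f (x + z))).
Proof.
move=> p0 pq cf.
pose k z := coth_kernel delta p z + 1.
have ck : continuous k by move=> z; apply: cvgD; [exact: coth_kernel_cont|exact: cvg_cst].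
have kE z : p <= z -> coth (pi * z / (2 * delta)) = k z.
  by move=> pz; rewrite /k /coth_kernel subrK (max_idPr pz) /coth_rate mulrAC.
pose h1 y := k (x - y) * f y.
pose h2 y := - (k (y - x) * f y).
have ch1 : continuous h1.
  by apply: continuous_mul => //; apply: (continuousT_comp ck); exact: continuous_subl.
have ch2 : continuous h2.
  move=> y; apply: cvgN; move: y; apply: continuous_mul => //.
  by apply: (continuousT_comp ck); exact: continuous_addr.
rewrite truncation_set// (@Rintegral_setU_piecewise _ _ _ _ h1 h2)//; first last.
- move=> y; rewrite inE/= in_itv/= => /andP[xy yx]; rewrite /h2 -kE; last by lra.
  by rewrite -mulNr -cothN; congr (coth _ * _); ring.
- move=> y; rewrite inE/= in_itv/= => /andP[xy yx]; rewrite /h1 -kE//; lra.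
- by apply: integrableS (continuous_integrable_itv (x + p) (x + q) ch2) => //; exact: subset_itvW.
- by apply: integrableS (continuous_integrable_itv (x - q) (x - p) ch1) => //; exact: subset_itvW.
- apply/seteqP; split => // y [] /=; rewrite !in_itv/= => /andP[? ?] /andP[? ?]; lra.
rewrite !Rintegral_itv_oo// ![x + _]addrC (Rintegral_shift _ ch1) ?lerN2// (Rintegral_shift _ ch2)//.
have c1 : continuous (fun y => h1 (y + x)) by apply: (continuousT_comp ch1); exact: continuous_addr.
have c2 : continuous (fun y => h2 (y + x)) by apply: (continuousT_comp ch2); exact: continuous_addr.
rewrite (Rintegral_reflect c1 pq) -RintegralD//.
- apply: eq_Rintegral => z _; rewrite /h1 /h2 addrK -/(k z).
  have -> : x - (- z + x) = z by ring.
  by rewrite [- z + x]addrC [z + x]addrC; ring.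
- apply: (@continuous_integrable_itv _ (fun y => h1 (- y + x))).
  by apply: (continuousT_comp c1) => y; exact: continuousN.
- exact: continuous_integrable_itv.
Qed.

(** The constant part 1 of coth integrates exactly, since f is a derivative.
    As p tends to 0 and q to infinity its contribution tends to 2 g1(x), which
    is what cancels the first order term of the equation. *)
Lemma truncated_Tdelta_split (p q x : R) (g1 f : R -> R) : 0 < p -> p <= q ->
  is_deriv g1 f -> continuous f ->
  \int[mu]_(y in [set y | p < `|x - y| < q]) (coth (pi * (x - y) / (2 * delta)) * f y) =
  \int[mu]_(z in `[p, q]) (coth_kernel delta p z * (f (x - z) - f (x + z)))
  + (g1 (x - p) + g1 (x + p) - g1 (x - q) - g1 (x + q)).
Proof.
move=> p0 pq gf cf; rewrite truncated_Tdelta//.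
have cd : continuous (fun z => f (x - z) - f (x + z)).
  move=> z; apply: cvgB; move: z; first by apply: (continuousT_comp cf); exact: continuous_subl.
  apply: (continuousT_comp cf) => z; rewrite /continuous_at.
  by apply: cvgD; [exact: cvg_cst|exact: cvg_id].
have ck : continuous (coth_kernel delta p) by exact: coth_kernel_cont.
under eq_Rintegral do rewrite mulrDl mul1r.
rewrite RintegralD//; [congr (_ + _)|apply: continuous_integrable_itv; exact: continuous_mul|exact: continuous_integrable_itv].
have dG : is_deriv (fun z => - g1 (x - z) - g1 (x + z)) (fun z => f (x - z) - f (x + z)).
  move=> z.
  have h1 : is_derive z (1:R) (fun z : R => x - z) (-1:R).
    by apply: is_derive_eq; ring.
  have h2 : is_derive z (1:R) (fun z : R => x + z) (1:R).
    by apply: is_derive_eq; ring.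
  have d1 := @is_derive1_comp R g1 (fun z : R => x - z) z _ _ (gf (x - z)) h1.
  have d2 := @is_derive1_comp R g1 (fun z : R => x + z) z _ _ (gf (x + z)) h2.
  have := is_deriveB (is_deriveN d1) d2.
  by move/(is_derive_eq); apply; ring.
rewrite (Rintegral_FTC dG)//; ring.
Qed.

End Trunc.

(** * The dispersive term against a weight *)

Section Dispersive.
Context {R : realType}.

Notation mu := (@lebesgue_measure R).
Context (delta : R).
Context (delta0 : 0 < delta).

Context (g g1 g2 g3 l : R -> R) (B1 B3 : R).
Context (d1 : is_deriv g g1).
Context (d2 : is_deriv g1 g2).
Context (d3 : is_deriv g2 g3).
Context (g1B : forall x, `|g1 x| <= B1).
Context (g3B : forall x, `|g3 x| <= B3).
Context (g1m : forall x, g1 (x - n.+1%:R) @[n --> \oo] --> (0 : R)).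
Context (g1p : forall x, g1 (x + n.+1%:R) @[n --> \oo] --> (0 : R)).
Context (hl : forall x, Tdelta_at delta g2 x (l x)).

Let cg := is_deriv_cont d1.
Let cg1 := is_deriv_cont d2.
Let cg2 := is_deriv_cont d3.

Definition truncated_dispersion (n : nat) (x : R) : R :=
  \int[mu]_(z in `[n.+1%:R^-1, n.+1%:R])
    (coth_kernel delta n.+1%:R^-1 z * (g2 (x - z) - g2 (x + z))).

Let p0 n : 0 < n.+1%:R^-1 :> R. Proof. by rewrite invr_gt0. Qed.
Let pq n : n.+1%:R^-1 <= n.+1%:R :> R.
Proof. by rewrite (@le_trans _ _ 1)// ?ler1n// invf_le1// ler1n. Qed.
Let B30 : 0 <= B3. Proof. by rewrite (le_trans _ (g3B 0)). Qed.
Let k0 : 0 < coth_rate delta. Proof. exact: coth_rate_gt0. Qed.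
Let kC0 : 0 < kernel_mass delta. Proof. exact: kernel_mass_gt0. Qed.

Let d2B x z : 0 <= z -> `|g2 (x - z) - g2 (x + z)| <= 2 * z * B3.
Proof.
move=> z0; rewrite distrC.
have := mean_value_le d3 g3B (_ : x - z <= x + z).
have -> : x + z - (x - z) = 2 * z by ring.
by apply; lra.
Qed.

Let cd x : continuous (fun z => g2 (x - z) - g2 (x + z)).
Proof.
move=> z; apply: cvgB; move: z; first by apply: (continuousT_comp cg2); exact: continuous_subl.
apply: (continuousT_comp cg2) => z; rewrite /continuous_at.
by apply: cvgD; [exact: cvg_cst|exact: cvg_id].
Qed.

Lemma truncated_dispersion_bound n x : `|truncated_dispersion n x| <= 2 * B3 * kernel_mass delta.
Proof.
apply: coth_kernel_integral_le => //.
  by apply: continuous_integrable_itv; apply: continuous_mul => //; exact: coth_kernel_cont.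
by move=> z z0; apply: d2B; exact: ltW.
Qed.

(** The operator T_delta g_xx + g_x / delta, with l for T_delta g_xx. *)
Definition dispersion x := l x + g1 x / delta.

(** The limit is along p = 1/(n+1) and q = n+1, one path of the joint limit that
    defines T_delta; the boundary terms at infinity vanish because g1 decays. *)
Lemma truncated_dispersion_cvg x : truncated_dispersion n x @[n --> \oo] --> - (2 * delta) * dispersion x.
Proof.
have invp : (n.+1%:R^-1 : R) @[n --> \oo] --> (0 : R)^'+.
  move=> P hP; have [N _ HN] := @cvg_harmonic R _ hP.
  by exists N => // n Nn; apply: (HN n Nn); exact: p0.
have invy : (n.+1%:R : R) @[n --> \oo] --> pinfty_nbhs R.
  by rewrite (cvg_shiftS (fun n => n%:R : R)); exact: cvgr_idn.
have inv0 : (n.+1%:R^-1 : R) @[n --> \oo] --> (0 : R) by exact: cvg_harmonic.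
have pr : (n.+1%:R^-1 : R, n.+1%:R : R) @[n --> \oo] --> ((0 : R)^'+, pinfty_nbhs R).
  exact: cvg_pair.
pose u (n : nat) := - (2 * delta)^-1 *
  \int[mu]_(y in [set y | n.+1%:R^-1 < `|x - y| < n.+1%:R])
    (coth (pi * (x - y) / (2 * delta)) * g2 y).
have h1 : u n @[n --> \oo] --> l x by exact: (cvg_comp _ _ pr (@hl x)).
have h2 : (g1 (x - n.+1%:R^-1) + g1 (x + n.+1%:R^-1) - g1 (x - n.+1%:R)
   - g1 (x + n.+1%:R)) @[n --> \oo] --> g1 x + g1 x - 0 - 0.
  apply: cvgB; last exact: g1p.
  apply: cvgB; last exact: g1m.
  apply: cvgD.
    apply: (@continuous_cvg _ _ _ _ _ (fun n : nat => x - n.+1%:R^-1) g1 x); first exact: cg1.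
    by rewrite -[X in _ --> X]subr0; apply: cvgB => //; exact: cvg_cst.
  apply: (@continuous_cvg _ _ _ _ _ (fun n : nat => x + n.+1%:R^-1) g1 x); first exact: cg1.
  by rewrite -[X in _ --> X]addr0; apply: cvgD => //; exact: cvg_cst.
have h0 : - (2 * delta) * u n @[n --> \oo] --> - (2 * delta) * l x.
  by apply: cvgM h1; exact: cvg_cst.
(* h2 is the limit 2 g1(x) of the contribution of the constant part of coth. *)
have h3 := cvgB h0 h2.
rewrite (_ : - (2 * delta) * dispersion x = - (2 * delta) * l x - (g1 x + g1 x - 0 - 0)); last first.
  by rewrite /dispersion; field; rewrite gt_eqF.
rewrite (_ : (fun n => truncated_dispersion n x) = (fun n => - (2 * delta) * u n -
  (g1 (x - n.+1%:R^-1) + g1 (x + n.+1%:R^-1) - g1 (x - n.+1%:R) - g1 (x + n.+1%:R)))); first exact: h3.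
apply/funext => n; rewrite /u (truncated_Tdelta_split delta0 x (p0 n) (pq n) d2 cg2) -/(truncated_dispersion n x).
by field; rewrite gt_eqF.
Qed.

Lemma dispersion_bound x : `|dispersion x| <= B3 * kernel_mass delta / delta.
Proof.
have h : `|- (2 * delta) * dispersion x| <= 2 * B3 * kernel_mass delta.
  by apply: cvg_norm_le (@truncated_dispersion_cvg x) _ => n; exact: truncated_dispersion_bound.
rewrite ler_pdivlMr// -(ler_pM2l (ltr0Sn R 1)).
move: h; rewrite normrM normrN (ger0_norm (_ : 0 <= 2 * delta)) ?mulr_ge0 ?(ltW delta0)//.
lra.
Qed.

Context (w w1 w2 w3 : R -> R) (A Cw C2 B : R).
Context (A0 : 0 <= A).
Context (e1 : is_deriv w w1).
Context (e2 : is_deriv w1 w2).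
Context (e3 : is_deriv w2 w3).
Context (cw3 : continuous w3).
Context (wC : forall x, `|w x| <= Cw).
Context (w2C : forall x, `|w2 x| <= C2).
Context (w_end : [/\ w A = 0, w (- A) = 0, w1 A = 0 & w1 (- A) = 0]).
Context (w2_end : w2 A = 0 /\ w2 (- A) = 0).
Context (conv_bound : forall s, `|\int[mu]_(x in `[- A, A]) (g (x + s) * w3 x)| <= B).

Let cw := is_deriv_cont e1.
Let cw1 := is_deriv_cont e2.
Let cw2 := is_deriv_cont e3.
Let mAA : - A <= A. Proof. by rewrite (@le_trans _ _ 0)// oppr_le0. Qed.
Let csh (f : R -> R) s : continuous f -> continuous (fun x => f (x + s)).
Proof. by move=> cf; apply: (continuousT_comp cf); exact: continuous_addr. Qed.

Let phi s := \int[mu]_(x in `[- A, A]) (g2 (x + s) * w x).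

(** Two integrations by parts move the derivatives of g2 to the weight. *)
Let phiE s : phi s = \int[mu]_(x in `[- A, A]) (g (x + s) * w2 x).
Proof.
have [wa wb wa1 wb1] := w_end.
rewrite /phi (Rintegral_by_parts0 (is_deriv_shift s d2) (@csh _ s cg2) e1 cw1 mAA wb wa).
by rewrite (Rintegral_by_parts0 (is_deriv_shift s d1) (@csh _ s cg1) e2 cw2 mAA wb1 wa1) opprK.
Qed.

Let phi_deriv : is_deriv phi (fun s => - \int[mu]_(x in `[- A, A]) (g (x + s) * w3 x)).
Proof.
have [wa wb] := w2_end.
rewrite (_ : phi = fun s => \int[mu]_(x in `[- A, A]) (g (x + s) * w2 x)); last first.
  by apply/funext => s; exact: phiE.
move=> s; have := is_deriv_conv A cw2 d1 w2C cg1 g1B s.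
by rewrite (Rintegral_by_parts0 (is_deriv_shift s d1) (@csh _ s cg1) e3 cw3 mAA wb wa).
Qed.

(** By the mean value inequality the symmetric difference of phi is controlled
    by the third derivative of the weight, with the linear factor z that the
    kernel requires. *)
Let phi_bound z : 0 < z -> `|phi (- z) - phi z| <= 2 * z * B.
Proof.
move=> z0; rewrite distrC.
have := mean_value_le phi_deriv (fun s => _ : `|_| <= B) (_ : - z <= z).
have -> : z - - z = 2 * z by ring.
by apply; [move=> s; rewrite normrN; exact: conv_bound|lra].
Qed.

(** The double integral of this function in x and z is the truncated dispersive
    term tested against w: integrating in z first gives the term itself,
    integrating in x first exposes the smoothness of the weight. *)
Let F n (xz : R * R) : R :=
  w xz.1 * (coth_kernel delta n.+1%:R^-1 xz.2 * (g2 (xz.1 - xz.2) - g2 (xz.1 + xz.2))).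

Let mF n : measurable_fun setT (F n).
Proof.
apply: measurable_funM.
  by apply: (measurableT_comp (continuous_measurable_fun cw)); exact: measurable_fst.
apply: measurable_funM.
  by apply: (measurableT_comp (continuous_measurable_fun (coth_kernel_cont delta0 (p0 n)))); exact: measurable_snd.
apply: measurable_funB.
  by apply: (measurableT_comp (continuous_measurable_fun cg2)); apply: measurable_funB.
by apply: (measurableT_comp (continuous_measurable_fun cg2)); apply: measurable_funD.
Qed.

Let FB n x z : - A <= x <= A -> n.+1%:R^-1 <= z <= n.+1%:R ->
  `|F n (x, z)| <= Cw * (2 * B3 * (2 / coth_rate delta)).
Proof.
move=> _ /andP[pz _]; have z0 : 0 < z by exact: lt_le_trans pz.
rewrite normrM ler_pM//= normrM ger0_norm ?coth_kernel_ge0//.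
apply: (@le_trans _ _ (coth_kernel delta n.+1%:R^-1 z * (2 * z * B3))).
  by rewrite ler_wpM2l ?coth_kernel_ge0 ?d2B// ltW.
rewrite (_ : _ * _ = 2 * B3 * (z * coth_kernel delta n.+1%:R^-1 z)); last by ring.
rewrite ler_wpM2l ?mulr_ge0//; apply: (le_trans (coth_kernel_bound delta0 (p0 n) pz)).
apply: ler_piMr; first by rewrite divr_ge0 ?(ltW k0).
rewrite expR_le1 mulNr oppr_le0.
by rewrite mulr_ge0 ?ltW.
Qed.

Let inner_z n x : \int[mu]_(z in `[n.+1%:R^-1, n.+1%:R]) F n (x, z) = w x * truncated_dispersion n x.
Proof.
rewrite /F /= RintegralZl//; apply: continuous_integrable_itv; apply: continuous_mul => //.
exact: coth_kernel_cont.
Qed.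

Let inner_x n z : \int[mu]_(x in `[- A, A]) F n (x, z) =
  coth_kernel delta n.+1%:R^-1 z * (phi (- z) - phi z).
Proof.
have i1 s : mu.-integrable `[- A, A] (EFin \o (fun x => g2 (x + s) * w x)).
  by apply: continuous_integrable_itv; apply: continuous_mul => //; exact: csh.
rewrite /phi -RintegralB// -RintegralZl//.
  by apply: eq_Rintegral => x _; rewrite /F /=; ring.
apply: (@continuous_integrable_itv _ (fun x => g2 (x - z) * w x - g2 (x + z) * w x)) => x.
apply: cvgB; [apply: cvgM; [exact: (@csh _ (- z) cg2)|exact: cw] |
  apply: cvgM; [exact: (@csh _ z cg2)|exact: cw] ].
Qed.

(** For the truncated operators, Fubini turns the pairing with w into the
    kernel integrated against a symmetric difference of phi, for which
    phi_bound and coth_kernel_integral_le give a bound independent of the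
    truncation; dominated convergence then removes the truncation.  Only B,
    which involves g and not its derivatives, enters the bound: this is why
    it survives the passage from smooth to L2 solutions. *)
Lemma dispersion_weighted_le :
  mu.-integrable `[- A, A] (EFin \o (fun x => dispersion x * w x)) /\ `|\int[mu]_(x in `[- A, A]) (dispersion x * w x)| <= B * kernel_mass delta / delta.
Proof.
have B0 : 0 <= B by rewrite (le_trans _ (conv_bound 0)).
have Cw0 : 0 <= Cw by rewrite (le_trans _ (wC 0)).
have fub n := Rintegral_exchange (mF n) (@FB n).
have [] := @Rintegral_dominated R (fun n x => w x * truncated_dispersion n x) (fun x => w x * (- (2 * delta) * dispersion x))
    (- A) A (Cw * (2 * B3 * kernel_mass delta)).
- move=> n; have [+ _] := fub n; apply: eq_integrable => // x _.
  by rewrite /= inner_z.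
- by move=> x _; apply: cvgM; [exact: cvg_cst|exact: truncated_dispersion_cvg].
- by move=> n x _; rewrite normrM ler_pM// truncated_dispersion_bound.
set G := fun x => w x * _; move=> iG cG.
have LE x : dispersion x * w x = - (2 * delta)^-1 * G x.
  by rewrite /G; field; rewrite gt_eqF.
have iL : mu.-integrable `[- A, A] (EFin \o (fun x => dispersion x * w x)).
  apply: eq_integrable (integrableZl _ (- (2 * delta)^-1) iG) => //.
  by move=> x _; rewrite /= LE.
split => //.
under eq_Rintegral do rewrite LE.
have d20 : 0 <= (2 * delta)^-1 by rewrite invr_ge0 mulr_ge0 ?(ltW delta0).
rewrite RintegralZl// normrM normrN (ger0_norm d20).
have h : `|\int[mu]_(x in `[- A, A]) G x| <= 2 * B * kernel_mass delta.
  apply: cvg_norm_le cG _ => n.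
  under eq_Rintegral do rewrite -inner_z.
  have [_ ->] := fub n.
  under eq_Rintegral do rewrite inner_x.
  apply: coth_kernel_integral_le => //.
  apply: continuous_integrable_itv; apply: continuous_mul; first exact: coth_kernel_cont.
  move=> z; have cphi := is_deriv_cont phi_deriv.
  apply: cvgB; last exact: cphi.
  by apply: continuous_comp; [exact: continuousN|exact: cphi].
rewrite [leRHS](_ : _ = (2 * delta)^-1 * (2 * B * kernel_mass delta)); last first.
  by field; rewrite gt_eqF.
by rewrite ler_wpM2l.
Qed.

End Dispersive.

(** * The virial inequality for smooth solutions *)

Section Decay.
Context {R : realType}.
Notation mu := (@lebesgue_measure R).

(** The local Sobolev inequality on windows that move to infinity, where the
    L2-masses of f and its derivative tend to 0. *)
Lemma L2_deriv_cvg0 (f f1 : R -> R) (y : nat -> R) : is_deriv f f1 -> continuous f1 ->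
  f \in L2 R -> f1 \in L2 R ->
  (forall z, \forall n \near \oo, ~~ (y n <= z <= y n + 1)) ->
  f (y n + 1) @[n --> \oo] --> (0 : R).
Proof.
move=> ff1 cf1 fL f1L yz; have cf := is_deriv_cont ff1.
apply/cvgr0Pnorm_le => e e0.
have e20 : 0 < e / 2 by rewrite divr_gt0.
have e40 : 0 < (e / 2) ^+ 2 by rewrite exprn_gt0.
have h0 := cvgr_le 0 (L2_cvg0_window fL cf yz) _ e40.
have h1 := cvgr_le 0 (L2_cvg0_window f1L cf1 yz) _ e40.
near=> n; rewrite [e]splitr.
apply: (sobolev_unit_itv ff1) => //; near: n; [exact: h0|exact: h1].
Unshelve. all: by end_near. Qed.

Lemma near_int_shift (x z : R) (e : R) : \forall n \near \oo, ~~ (x + n.+1%:R + e <= z <= x + n.+1%:R + e + 1).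
Proof.
near=> n; rewrite negb_and -ltNge; apply/orP; left.
have : z - x - e < n%:R by near: n; exact: nbhs_infty_gtr.
by rewrite -natr1; lra.
Unshelve. all: by end_near. Qed.

Lemma near_int_shiftN (x z : R) (e : R) : \forall n \near \oo, ~~ (x - n.+1%:R + e <= z <= x - n.+1%:R + e + 1).
Proof.
near=> n; rewrite negb_and; apply/orP; right; rewrite -ltNge.
have : x + e + 1 - z < n%:R by near: n; exact: nbhs_infty_gtr.
by rewrite -natr1; lra.
Unshelve. all: by end_near. Qed.

End Decay.

Section Virial.
Context {R : realType}.
Notation mu := (@lebesgue_measure R).
Context (delta : R).
Context (delta0 : 0 < delta).
Context (phi : R -> R) (v : R -> R -> R).
Context (hv : smooth_ILW_solution delta phi v).

Let V k t : R -> R := (v t)^`(k)%classic.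

Lemma smooth_is_deriv k t : is_deriv (V k t) (V k.+1 t).
Proof. by have [h _ _ _] := hv; apply: derivable_is_deriv; exact: (h t k).1. Qed.

Lemma smooth_L2 k t : V k t \in L2 R.
Proof. by have [h _ _ _] := hv; exact: (h t k).2. Qed.

Lemma smooth_continuous k t : continuous (V k t).
Proof. exact: is_deriv_cont (smooth_is_deriv k t). Qed.

Lemma smooth_L2norm_bound k t : exists2 N, 0 < N & (L2norm (V k t) <= N%:E)%E.
Proof.
have h := L2norm_fin (smooth_L2 k t); have h0 := L2norm_ge0 (V k t).
exists (fine (L2norm (V k t)) + 1); first by rewrite ltr_wpDl ?fine_ge0.
by rewrite EFinD fineK ?ge0_fin_numE// leeDl// lee_fin.
Qed.

(** Local uniformity in time, from continuity in L2 of each space derivative. *)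
Lemma smooth_L2norm_near k t : exists r N : R, [/\ 0 < r, 0 < N &
  forall s, `|s - t| < r -> (L2norm (V k s) <= N%:E)%E].
Proof.
have [N N0 hN] := smooth_L2norm_bound k t.
have [_ h _ _] := hv; have [_ /(_ t I)] := h k.
move=> /fine_cvgP[hf /cvgrPdist_lt/(_ 1 ltr01)].
move: hf => [r /= r0 hr] [r' /= r'0 hr'].
exists (Num.min r r'), (N + 1); split; [by rewrite lt_min r0|exact: addr_gt0|].
move=> s; rewrite lt_min => /andP[sr sr'].
have hfin := hr s (ltac:(by rewrite /= distrC)) I.
have hlt := hr' s (ltac:(by rewrite /= distrC)) I.
rewrite /= in hfin hlt; rewrite sub0r normrN in hlt.
apply: (@L2norm_le_near _ _ (V k t)) => //.
- exact: L2_measurable (smooth_L2 _ _).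
- exact: L2_measurable (smooth_L2 _ _).
- rewrite -(fineK hfin) lee_fin; apply: le_trans (ltW hlt); exact: ler_norm.
Qed.

(** Supplies the dominating constants for differentiating under the integral in
    time. *)
Lemma smooth_sup_near k t : exists r B : R, [/\ 0 < r, 0 < B &
  forall s x, `|s - t| < r -> `|V k s x| <= B].
Proof.
have [r [N [r0 N0 h]]] := smooth_L2norm_near k t.
have [r' [N' [r'0 N'0 h']]] := smooth_L2norm_near k.+1 t.
exists (Num.min r r'), (N + N'); split.
- by rewrite lt_min r0.
- by rewrite addr_gt0.
move=> s x; rewrite lt_min => /andP[sr sr'].
by apply: (sobolev_sup (smooth_is_deriv k s)) => //; [exact: smooth_continuous|exact: h|exact: h'].
Qed.

Lemma smooth_cvg0_right k t x : V k t (x + n.+1%:R) @[n --> \oo] --> (0 : R).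
Proof.
have := @L2_deriv_cvg0 R (V k t) (V k.+1 t) (fun n => x + n.+1%:R - 1).
under eq_fun do rewrite subrK.
apply; [exact: smooth_is_deriv|exact: smooth_continuous|exact: smooth_L2|exact: smooth_L2|].
by move=> z; exact: near_int_shift.
Qed.

Lemma smooth_cvg0_left k t x : V k t (x - n.+1%:R) @[n --> \oo] --> (0 : R).
Proof.
have := @L2_deriv_cvg0 R (V k t) (V k.+1 t) (fun n => x - n.+1%:R - 1).
under eq_fun do rewrite subrK.
apply; [exact: smooth_is_deriv|exact: smooth_continuous|exact: smooth_L2|exact: smooth_L2|].
by move=> z; exact: near_int_shiftN.
Qed.

Lemma smooth_equation t : exists l : R -> R, (forall x, Tdelta_at delta (V 2 t) x (l x)) /\
  forall x, (fun s => v s x)^`()%classic t = - dispersion delta (V 1 t) l x - v t x * V 1 t x.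
Proof.
have [_ _ _ h] := hv.
have ht x : exists lx, Tdelta_at delta (V 2 t) x lx /\
   (fun s => v s x)^`()%classic t + lx + delta^-1 * V 1 t x + v t x * V 1 t x = 0.
  by have [_ [lx h1 h2]] := h t x; exists lx; split.
have [l hl] := choice ht.
exists l; split => x; first exact: (hl x).1.
have [_ e] := hl x; rewrite /dispersion [_ / delta]mulrC; lra.
Qed.

Lemma smooth_derivable_time t x : derivable (fun s => v s x) t 1.
Proof. by have [_ _ _ h] := hv; have [] := h t x. Qed.

Context (w w1 w2 w3 : R -> R) (A Cw C2 : R).
Context (A0 : 0 <= A).
Context (e1 : is_deriv w w1).
Context (e2 : is_deriv w1 w2).
Context (e3 : is_deriv w2 w3).
Context (cw3 : continuous w3).
Context (wC : forall x, `|w x| <= Cw).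
Context (w2C : forall x, `|w2 x| <= C2).
Context (w_end : [/\ w A = 0, w (- A) = 0, w1 A = 0 & w1 (- A) = 0]).
Context (w2_end : w2 A = 0 /\ w2 (- A) = 0).

Let cw := is_deriv_cont e1.
Let cw1 := is_deriv_cont e2.

(** The functional J, linear in the solution: the nonlinearity u u_x contributes
    the definite quadratic term to its derivative. *)
Definition weighted_integral t := \int[mu]_(x in `[- A, A]) (v t x * w x).

(** Differentiate under the integral and insert the equation.  The nonlinear
    term v v_x = (v^2 / 2)_x is integrated by parts, and the dispersive term is
    bounded by dispersion_weighted_le. *)
Lemma virial_inequality t B :
  (forall s, `|\int[mu]_(x in `[- A, A]) (v t (x + s) * w3 x)| <= B) ->
  derivable weighted_integral t 1 /\
  2^-1 * \int[mu]_(x in `[- A, A]) (v t x ^+ 2 * w1 x) - B * kernel_mass delta / delta <=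
  weighted_integral^`()%classic t.
Proof.
move=> hB.
have [r0 [B0 [r00 B00 h0]]] := smooth_sup_near 0 t.
have [r1 [B1 [r10 B10 h1]]] := smooth_sup_near 1 t.
have [r3 [B3 [r30 B30 h3]]] := smooth_sup_near 3 t.
(* A time interval on which v, v_x and v_xxx are bounded uniformly: v_xxx
   controls the dispersive term and the other two the nonlinear one. *)
pose r := Num.min r0 (Num.min r1 r3).
have rp : 0 < r by rewrite !lt_min r00 r10 r30.
have hs s : `]t - r, t + r[%classic s -> [/\ `|s - t| < r0, `|s - t| < r1 & `|s - t| < r3].
  rewrite /= in_itv/= => st.
  have : `|s - t| < r by rewrite ltr_distl.
  by rewrite !lt_min => /and3P[].
have Cw0 : 0 <= Cw by rewrite (le_trans _ (wC 0)).
have mAA : - A <= A by rewrite (@le_trans _ _ 0)// oppr_le0.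
pose C := (B3 * kernel_mass delta / delta + B0 * B1) * Cw.
have dv s x : is_derive s (1:R) (fun s' => v s' x * w x) ((fun s' => v s' x)^`()%classic s * w x).
  have d : is_derive s (1:R) (fun s' => v s' x) ((fun s' => v s' x)^`()%classic s).
    by split; [exact: smooth_derivable_time|rewrite derive1E].
  have := is_deriveM d (is_derive_cst (w x) s (1:R)).
  by move/is_derive_eq; apply; rewrite /GRing.scale/=; ring.
pose f s x := v s x * w x.
have d1 s x : partial1of2 f s x = (fun s' => v s' x)^`()%classic s * w x.
  by rewrite /partial1of2 derive1E; apply: (@derive_val _ _ _ _ _ _ _ (dv s x)).
have Is : [set` `]t - r, t + r[] t by rewrite /= in_itv/= ltrBlDr ltrDl rp.
have mD : measurable (`[- A, A]%classic : set (measurableTypeR R)) by [].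
have hi s : [set` `]t - r, t + r[] s -> mu.-integrable `[- A, A] (EFin \o f s).
  by move=> _; apply: continuous_integrable_itv; apply: continuous_mul => //; exact: (@smooth_continuous 0 _).
have hd s x : [set` `]t - r, t + r[] s -> `[- A, A]%classic x -> derivable (f ^~ x) s 1.
  by move=> _ _; have [] := dv s x.
have hG : mu.-integrable `[- A, A] (EFin \o (cst C : R -> R)).
  by apply: continuous_integrable_itv => x; exact: cvg_cst.
have hb s x : [set` `]t - r, t + r[] s -> `[- A, A]%classic x ->
    `|partial1of2 f s x| <= (cst C : R -> R) x.
  move=> /hs[s0 s1 s3] _; rewrite d1 normrM ler_pM//.
  have [l [hl ->]] := smooth_equation s.
  rewrite (le_trans (ler_normB _ _))// normrN lerD//.
    exact: (dispersion_bound delta0 (smooth_is_deriv 1 s) (smooth_is_deriv 2 s) (fun y => h3 s y s3)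
      (smooth_cvg0_left 1 s) (smooth_cvg0_right 1 s) hl).
  by rewrite normrM ler_pM//; [exact: h0|exact: h1].
have G0 (x : R) : 0 <= (cst C : R -> R) x.
  have k0 : 0 < kernel_mass delta by exact: kernel_mass_gt0.
  apply: mulr_ge0 => //; apply: addr_ge0; last by apply: mulr_ge0; exact: ltW.
  by apply: divr_ge0; [apply: mulr_ge0|]; exact: ltW.
split.
  exact: (@derivable_under_integral R _ _ mu f _ mD t _ _ Is hi hd _ G0 hG hb).
rewrite (@differentiation_under_integral R _ _ mu f _ mD t _ _ Is hi hd _ G0 hG hb).
have [l [hl el]] := smooth_equation t.
have tt (r' : R) : 0 < r' -> `|t - t| < r' by rewrite subrr normr0.
have [iL] := @dispersion_weighted_le R delta delta0 (v t) (V 1 t) (V 2 t) (V 3 t) l B1 B3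
  (smooth_is_deriv 0 t) (smooth_is_deriv 1 t) (smooth_is_deriv 2 t) (fun x => h1 t x (tt _ r10)) (fun x => h3 t x (tt _ r30))
  (smooth_cvg0_left 1 t) (smooth_cvg0_right 1 t) hl w w1 w2 w3 A Cw C2 B A0 e1 e2 e3 cw3 wC w2C w_end w2_end hB.
rewrite ler_norml => /andP[_ hL].
pose q x := v t x ^+ 2 / 2.
have dq : is_deriv q (fun x => v t x * V 1 t x).
  have dh : is_deriv (fun _ : R => 2^-1 : R) (fun _ => 0) by move=> x; exact: is_derive_cst.
  move=> x; have := is_derivM (is_derivM (smooth_is_deriv 0 t) (smooth_is_deriv 0 t)) dh x.
  by move/is_derive_eq; apply; rewrite -[V 0 t]/(v t); field.
have cq := is_deriv_cont dq.
have cqq : continuous (fun x => v t x * V 1 t x) by apply: continuous_mul; [exact: (@smooth_continuous 0 t)|exact: (@smooth_continuous 1 t)].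
have -> : \int[mu]_(y in `[- A, A]) partial1of2 f t y =
   - (\int[mu]_(x in `[- A, A]) (dispersion delta (V 1 t) l x * w x)) - \int[mu]_(x in `[- A, A]) ((v t x * V 1 t x) * w x).
  have i2 : mu.-integrable `[- A, A] (EFin \o (fun x => (v t x * V 1 t x) * w x)).
    by apply: continuous_integrable_itv; apply: continuous_mul.
  have -> : - (\int[mu]_(x in `[- A, A]) (dispersion delta (V 1 t) l x * w x)) =
     \int[mu]_(x in `[- A, A]) (- 1 * (dispersion delta (V 1 t) l x * w x)).
    by rewrite RintegralZl// mulN1r.
  rewrite -RintegralB//.
    by apply: eq_Rintegral => x _; rewrite d1 el; ring.
  apply: eq_integrable (integrableZl _ (-1) iL) => //.
have [wa wb _ _] := w_end.
rewrite (Rintegral_by_parts0 dq cqq e1 cw1 mAA wb wa) opprK.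
have -> : \int[mu]_(x in `[- A, A]) (q x * w1 x) = 2^-1 * \int[mu]_(x in `[- A, A]) (v t x ^+ 2 * w1 x).
  rewrite -RintegralZl//; last first.
    apply: continuous_integrable_itv; apply: continuous_mul => //.
    by apply: (@continuous_mul _ (v t) (v t)); exact: (@smooth_continuous 0 _).
  by apply: eq_Rintegral => x _; rewrite /q; ring.
by rewrite addrC lerD2r lerN2.
Qed.

End Virial.

(** * A C3 step function *)

Section Clamp.
Context {R : realType}.
Notation mu := (@lebesgue_measure R).

Definition clamp (y : R) : R := Num.max (-1) (Num.min 1 y).

Lemma clampP y : (-1 <= clamp y <= 1).
Proof. by rewrite /clamp le_max lexx ge_max ge_min lexx (le_trans (lerN10 R) ler01). Qed.

Lemma clamp_id y : -1 <= y <= 1 -> clamp y = y.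
Proof. by move=> /andP[h1 h2]; rewrite /clamp (min_idPr h2) (max_idPr h1). Qed.

Lemma clamp_ge y : 1 <= y -> clamp y = 1.
Proof. by move=> h; rewrite /clamp (min_idPl h); apply/max_idPr; rewrite (le_trans (lerN10 R) ler01). Qed.

Lemma clamp_le y : y <= -1 -> clamp y = -1.
Proof.
move=> h; rewrite /clamp (min_idPr _); last by rewrite (le_trans h)// (le_trans (lerN10 R) ler01).
exact/max_idPl.
Qed.

Lemma clamp_cont : continuous clamp.
Proof.
move=> y; rewrite /clamp.
have h : {for y, continuous (fun y : R => Num.min 1 y)}.
  by apply: continuous_min; [exact: cvg_cst|exact: cvg_id].
exact: (@continuous_max R R (fun=> -1) (fun y => Num.min 1 y) y (@cvg_cst _ _ _ _ _) h).
Qed.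

Lemma clamp_lip y z : `|clamp y - clamp z| <= `|y - z|.
Proof.
wlog yz : y z / y <= z.
  move=> H; case: (leP y z) => [|/ltW] /H //.
  by rewrite distrC [leRHS]distrC.
rewrite [leRHS]distrC [leLHS]distrC (@ger0_norm _ (z - y)) ?subr_ge0//.
have [z1|z1] := leP z (-1).
  by rewrite !clamp_le ?(le_trans yz)// subrr normr0 subr_ge0.
have [y1|y1] := leP 1 y.
  by rewrite !clamp_ge ?(le_trans y1)// subrr normr0 subr_ge0.
have [y2|y2] := leP y (-1); have [z2|z2] := leP 1 z.
- by rewrite (clamp_le y2) (clamp_ge z2) ger0_norm; lra.
- by rewrite (clamp_le y2) clamp_id ?(ltW z1) ?(ltW z2)// ger0_norm; lra.
- by rewrite (clamp_ge z2) clamp_id ?(ltW y1) ?(ltW y2)// ger0_norm; lra.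
- by rewrite !clamp_id ?(ltW y1) ?(ltW y2) ?(ltW z1) ?(ltW z2)// ger0_norm; lra.
Qed.

(** Composing with the clamp keeps one derivative as soon as p vanishes at
    both ends: at an end point the difference quotient of P at the clamped
    points tends to p = 0, and the clamp is 1-Lipschitz. *)
Lemma clamp_deriv (P p : R -> R) : is_deriv P p -> p 1 = 0 -> p (-1) = 0 ->
  is_deriv (fun y => P (clamp y)) (fun y => p (clamp y)).
Proof.
move=> Pp p1 pN1 x.
have [/andP[h1 h2]|hx] := boolP (-1 < x < 1).
  rewrite (clamp_id (_ : -1 <= x <= 1)) ?(ltW h1) ?(ltW h2)//.
  apply: (@near_eq_is_derive _ _ _ P) => //.
  near=> y; rewrite clamp_id//; apply/andP; split; apply: ltW; near: y.
    exact: lt_nbhsr.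
  exact: lt_nbhsl.
have pc0 : p (clamp x) = 0.
  move: hx; rewrite negb_and -!leNgt => /orP[h|h]; first by rewrite clamp_le.
  by rewrite clamp_ge.
rewrite pc0; have /is_derive1_caratheodory[g [gP cg gx]] := Pp (clamp x).
apply/is_derive1_caratheodory.
(* Caratheodory slope of the composition: that of P times the difference
   quotient of the clamp, which is at most 1 in absolute value. *)
pose G z := g (clamp z) * ((clamp z - clamp x) / (z - x)).
have Gx : G x = 0 by rewrite /G subrr mul0r mulr0.
exists G; split; last exact: Gx.
- move=> z; rewrite /G gP; have [->|zx] := eqVneq z x; first by rewrite !subrr !mulr0.
  by field; rewrite subr_eq0.
- rewrite /prop_for /continuous_at Gx.
  apply/norm_cvg0P.
  apply: (@squeeze_cvgr _ _ _ _ (cst 0) (fun z => `|g (clamp z)|)).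
  + apply: nearW => z /=; rewrite normr_ge0/= normrM ler_piMr//.
    have [->|zx] := eqVneq z x; first by rewrite !subrr mul0r normr0.
    by rewrite normrM normfV ler_pdivrMr ?mul1r ?clamp_lip// normr_gt0 subr_eq0.
  + exact: cvg_cst.
  + have : g (clamp z) @[z --> x] --> g (clamp x).
      by apply: continuous_comp; [exact: clamp_cont|exact: cg].
    by move=> /cvg_norm; rewrite gx pc0 normr0.
Unshelve. all: by end_near. Qed.

Definition bump3_int (y : R) := y - y ^+ 3 + 3 / 5 * y ^+ 5 - 7^-1 * y ^+ 7.
(** The cube is the lowest power for which the first two derivatives vanish at
    the end points, so that clamp_deriv applies three times. *)
Definition bump3 (y : R) := (1 - y ^+ 2) ^+ 3.
Definition bump3_d1 (y : R) := - 6 * y * (1 - y ^+ 2) ^+ 2.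
Definition bump3_d2 (y : R) := (1 - y ^+ 2) * (30 * y ^+ 2 - 6).

Lemma bump3_int_deriv : is_deriv bump3_int bump3.
Proof. by move=> y; apply: is_derive_eq; rewrite /bump3 /GRing.scale/= ; field. Qed.
Lemma bump3_deriv : is_deriv bump3 bump3_d1.
Proof. by move=> y; apply: is_derive_eq; rewrite /bump3_d1 /GRing.scale/= ; field. Qed.
Lemma bump3_d1_deriv : is_deriv bump3_d1 bump3_d2.
Proof. by move=> y; apply: is_derive_eq; rewrite /bump3_d2 /GRing.scale/= ; field. Qed.

Definition step y := bump3_int (clamp y).
Definition step_d1 y := bump3 (clamp y).
Definition step_d2 y := bump3_d1 (clamp y).
Definition step_d3 y := bump3_d2 (clamp y).

Lemma step_deriv : is_deriv step step_d1.
Proof. by apply: clamp_deriv; [exact: bump3_int_deriv|rewrite /bump3; ring..]. Qed.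
Lemma step_d1_deriv : is_deriv step_d1 step_d2.
Proof. by apply: clamp_deriv; [exact: bump3_deriv|rewrite /bump3_d1; ring..]. Qed.
Lemma step_d2_deriv : is_deriv step_d2 step_d3.
Proof. by apply: clamp_deriv; [exact: bump3_d1_deriv|rewrite /bump3_d2; ring..]. Qed.
Lemma step_d3_cont : continuous step_d3.
Proof.
apply: (continuousT_comp _ clamp_cont) => y.
have d : is_derive y (1:R) bump3_d2 (- 2 * y * (30 * y ^+ 2 - 6) + (1 - y ^+ 2) * (60 * y)).
  by apply: is_derive_eq; rewrite /GRing.scale/= ; field.
by apply: differentiable_continuous; apply/derivable1_diffP; have [] := d.
Qed.

Lemma step_ge1 y : 1 <= y -> step y = bump3_int 1. Proof. by move=> h; rewrite /step clamp_ge. Qed.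
Lemma step_leN1 y : y <= -1 -> step y = bump3_int (-1). Proof. by move=> h; rewrite /step clamp_le. Qed.

Lemma step_derivs_out y : ~~ (-1 < y < 1) -> [/\ step_d1 y = 0, step_d2 y = 0 & step_d3 y = 0].
Proof.
rewrite negb_and -!leNgt /step_d1 /step_d2 /step_d3 => /orP[h|h]; [rewrite clamp_le//|rewrite clamp_ge//];
  by rewrite /bump3 /bump3_d1 /bump3_d2; split; ring.
Qed.

Lemma sqr_clamp y : 0 <= clamp y ^+ 2 <= 1.
Proof.
have /andP[h1 h2] := clampP y; rewrite sqr_ge0/=.
by rewrite -subr_ge0 (_ : _ - _ = (1 - clamp y) * (1 - - clamp y)) ?mulr_ge0; [|lra|lra|ring].
Qed.

Lemma step_d1_bound y : 0 <= step_d1 y <= 1.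
Proof.
have /andP[h1 h2] := sqr_clamp y; rewrite /step_d1 /bump3; apply/andP; split.
  by rewrite exprn_ge0// subr_ge0.
by rewrite exprn_ile1 ?subr_ge0//; lra.
Qed.

Lemma step_bound y : `|step y| <= 1.
Proof.
have /andP[h1 h2] := clampP y.
have h : `|step y - step 0| <= `|clamp y|.
  have e z : step z = step (clamp z) by rewrite /step (clamp_id (clampP z)).
  have B z : `|step_d1 z| <= 1 by have /andP[? ?] := step_d1_bound z; rewrite ger0_norm.
  rewrite e; have [y0|y0] := leP 0 (clamp y).
    by have := mean_value_le step_deriv B y0; rewrite subr0 mulr1 (ger0_norm y0).
  have := mean_value_le step_deriv B (ltW y0); rewrite sub0r mulr1 (ltr0_norm y0).
  by rewrite distrC.
have e0 : step 0 = 0 by rewrite /step clamp_id ?ler01 ?lerN10 ?oppr_le0//= /bump3_int; ring.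
by move: h; rewrite e0 subr0 => /le_trans; apply; rewrite ler_norml h1 h2.
Qed.

Lemma step_d2_bound y : `|step_d2 y| <= 6.
Proof.
have /andP[h1 h2] := clampP y; have /andP[h3 h4] := sqr_clamp y.
rewrite /step_d2 /bump3_d1 !normrM normrN (ger0_norm (ler0n R 6)).
have c1 : `|clamp y| <= 1 by rewrite ler_norml h1 h2.
have q1 : `|1 - clamp y ^+ 2| <= 1 by rewrite ger0_norm; lra.
have q2 : `|1 - clamp y ^+ 2| ^+ 2 <= 1 by rewrite exprn_ile1.
have := ler_pM (normr_ge0 _) (exprn_ge0 2 (normr_ge0 _)) c1 q2.
rewrite mulr1 => h; rewrite -mulrA -[leRHS]mulr1 ler_pM2l//.
Qed.

Lemma step_d3_bound y : `|step_d3 y| <= 30.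
Proof.
have /andP[h3 h4] := sqr_clamp y.
rewrite /step_d3 /bump3_d2 normrM -[leRHS]mul1r ler_pM//.
  by rewrite ger0_norm; lra.
by rewrite ler_norml; apply/andP; split; lra.
Qed.

(** The bound is (1 - (1/2)^2)^3. *)
Lemma step_d1_ge y : -1/2 <= y <= 1/2 -> 27/64 <= step_d1 y.
Proof.
move=> /andP[h1 h2]; rewrite /step_d1 clamp_id; last by apply/andP; split; lra.
rewrite /bump3 (_ : 27/64 = (3/4) ^+ 3); last by field.
rewrite lerXn2r ?nnegrE//.
  by apply: le_trans (_ : 3 / 4 <= _) => //; nra.
by nra.
Qed.

End Clamp.

(** * The weight *)

Section Bounds.
Context {R : realType}.
Notation mu := (@lebesgue_measure R).

Context (c lam lam1 : R).
Context (lam0 : 0 < lam).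
Context (lam01 : lam <= lam1).

Let k := lam^-1.
Let k1 := lam1^-1.
Let k0 : 0 < k. Proof. by rewrite invr_gt0. Qed.
Let lam10 : 0 < lam1. Proof. exact: lt_le_trans lam01. Qed.
Let k10 : 0 < k1. Proof. by rewrite invr_gt0. Qed.

(** The interval of integration is chosen symmetric about 0, large enough to
    contain the support of the weight. *)
Definition weight_radius : R := `|c| + lam1.

(** The wide step has the same constant values as the narrow one far from c, so
    the difference has compact support.  The factors 1 make the formulas for
    the derivatives instances of is_deriv_scale. *)
Definition weight x := 1 * step (k * (x - c)) - 1 * step (k1 * (x - c)).
Definition weight_d1 x := 1 * k * step_d1 (k * (x - c)) - 1 * k1 * step_d1 (k1 * (x - c)).
Definition weight_d2 x := 1 * k * k * step_d2 (k * (x - c)) - 1 * k1 * k1 * step_d2 (k1 * (x - c)).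
Definition weight_d3 x := 1 * k * k * k * step_d3 (k * (x - c)) - 1 * k1 * k1 * k1 * step_d3 (k1 * (x - c)).

Lemma weight_deriv : is_deriv weight weight_d1.
Proof. by apply: is_derivB; apply: is_deriv_scale; exact: step_deriv. Qed.
Lemma weight_d1_deriv : is_deriv weight_d1 weight_d2.
Proof. by apply: is_derivB; apply: is_deriv_scale; exact: step_d1_deriv. Qed.
Lemma weight_d2_deriv : is_deriv weight_d2 weight_d3.
Proof. by apply: is_derivB; apply: is_deriv_scale; exact: step_d2_deriv. Qed.

Lemma continuous_scale_aff (a r : R) (f : R -> R) : continuous f ->
  continuous (fun x => a * f (r * (x - c))).
Proof.
move=> cf; apply: continuous_mul; first by move=> x; exact: cvg_cst.
apply: (continuousT_comp cf); apply: continuous_mul; first by move=> x; exact: cvg_cst.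
exact: continuous_addr.
Qed.

Lemma weight_d3_cont : continuous weight_d3.
Proof. by move=> x; apply: cvgB; apply: continuous_scale_aff; exact: step_d3_cont. Qed.

Let out (L x : R) : 0 < L -> ~~ (c - L < x < c + L) -> ~~ (-1 < L^-1 * (x - c) < 1).
Proof.
move=> L0; apply: contra => /andP[].
rewrite -ltr_pdivrMl ?invr_gt0// invrK => h1.
rewrite ltr_pdivrMl// => h2.
by apply/andP; split; lra.
Qed.

Lemma weight_radius_ge : c + lam1 <= weight_radius /\ - weight_radius <= c - lam1.
Proof.
by rewrite /weight_radius; have := ler_norm c; have := ler_norm (- c); rewrite normrN; split; lra.
Qed.

Lemma weight_radius_ge0 : 0 <= weight_radius. Proof. by rewrite addr_ge0// ltW. Qed.

Let end_out L : 0 < L -> L <= lam1 -> ~~ (c - L < weight_radius < c + L) /\ ~~ (c - L < - weight_radius < c + L).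
Proof.
move=> L0 Ll; have [h1 h2] := weight_radius_ge; split; rewrite negb_and -!leNgt.
  by apply/orP; right; lra.
by apply/orP; left; lra.
Qed.

Lemma weight_out (x : R) : ~~ (c - lam1 <= x <= c + lam1) -> weight x = 0.
Proof.
rewrite negb_and -!ltNge /weight !mul1r => /orP[h|h].
  have g1 : x - c <= - lam1 by lra.
  have g2 : x - c <= - lam by rewrite (le_trans g1)// lerN2.
  by rewrite !step_leN1 ?subrr//; rewrite ler_pdivrMl// mulrN1.
have g1 : lam1 <= x - c by lra.
have g2 : lam <= x - c by exact: le_trans g1.
by rewrite !step_ge1 ?subrr//; rewrite ler_pdivlMl// mulr1.
Qed.

Lemma weight_end0 : weight weight_radius = 0 /\ weight (- weight_radius) = 0.
Proof.
have [h1 h2] := weight_radius_ge; rewrite /weight !mul1r; split.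
  have g1 : lam1 <= weight_radius - c by lra.
  have g2 : lam <= weight_radius - c by exact: le_trans g1.
  by rewrite !step_ge1 ?subrr//; rewrite ler_pdivlMl// mulr1.
have g1 : - weight_radius - c <= - lam1 by lra.
have g2 : - weight_radius - c <= - lam by rewrite (le_trans g1)// lerN2.
by rewrite !step_leN1 ?subrr//; rewrite ler_pdivrMl// mulrN1.
Qed.

Let derivs_out (x : R) : ~~ (c - lam1 < x < c + lam1) -> ~~ (c - lam < x < c + lam) ->
  [/\ weight_d1 x = 0, weight_d2 x = 0 & weight_d3 x = 0].
Proof.
move=> /(out lam10)/step_derivs_out[a1 a2 a3] /(out lam0)/step_derivs_out[b1 b2 b3].
by rewrite /weight_d1 /weight_d2 /weight_d3 /k /k1 a1 a2 a3 b1 b2 b3 !mulr0 subrr.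
Qed.

Lemma weight_end : [/\ weight weight_radius = 0, weight (- weight_radius) = 0, weight_d1 weight_radius = 0 & weight_d1 (- weight_radius) = 0].
Proof.
have [a1 a2] := end_out lam0 lam01; have [b1 b2] := end_out lam10 (lexx _).
have [c1 _ _] := derivs_out b1 a1; have [d1 _ _] := derivs_out b2 a2.
by have [? ?] := weight_end0; split.
Qed.

Lemma weight_d2_end : weight_d2 weight_radius = 0 /\ weight_d2 (- weight_radius) = 0.
Proof.
have [a1 a2] := end_out lam0 lam01; have [b1 b2] := end_out lam10 (lexx _).
by have [_ c1 _] := derivs_out b1 a1; have [_ d1 _] := derivs_out b2 a2.
Qed.

Lemma weight_bound x : `|weight x| <= 2.
Proof.
rewrite /weight !mul1r (le_trans (ler_normB _ _))//.
by rewrite -[leRHS]/(1 + 1 : R) lerD// step_bound.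
Qed.

Lemma weight_d2_bound x : `|weight_d2 x| <= k * k * 6 + k1 * k1 * 6.
Proof.
have h (r y : R) : 0 < r -> `|r * r * step_d2 y| <= r * r * 6.
  move=> r0; have rr : 0 < r * r by rewrite mulr_gt0.
  by rewrite normrM (gtr0_norm rr) ler_pM2l// step_d2_bound.
by rewrite /weight_d2 !mul1r (le_trans (ler_normB _ _))// lerD// h.
Qed.

Context (g : R -> R) (N : R).
Context (cg : continuous g).
Context (N0 : 0 < N).
Context (gN : (L2norm g <= N%:E)%E).

(** Cauchy-Schwarz on the support, which has length 2 lam1. *)
Lemma weight_integral_le : `|\int[mu]_(x in `[- weight_radius, weight_radius]) (g x * weight x)| <= 2 * (Num.sqrt (2 * lam1) * N).
Proof.
have [h1 h2] := weight_radius_ge; have l1 := lam10.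
have -> : 2 * lam1 = (c + lam1) - (c - lam1) by ring.
apply: Rintegral_mul_le => //.
- by lra.
- exact: is_deriv_cont weight_deriv.
- exact: weight_bound.
- exact: weight_out.
- exact: L2norm_Rintegral.
Qed.

(** The third derivative at scale L has size L^-3 and support of length 2 L,
    whence L^(-5/2) by Cauchy-Schwarz. *)
Let conv1 L s : 0 < L -> L <= lam1 ->
  `|\int[mu]_(x in `[- weight_radius, weight_radius]) (g (x + s) * (1 * L^-1 * L^-1 * L^-1 * step_d3 (L^-1 * (x - c))))| <=
  30 * L^-1 ^+ 3 * (Num.sqrt (2 * L) * N).
Proof.
move=> L0 Ll; have [h1 h2] := weight_radius_ge.
have -> : 2 * L = (c + L) - (c - L) by ring.
apply: Rintegral_mul_le => //.
- by lra.
- by lra.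
- by lra.
- by apply: (continuousT_comp cg); exact: continuous_addr.
- by apply: continuous_scale_aff; exact: step_d3_cont.
- move=> x; rewrite mul1r normrM ger0_norm ?mulr_ge0 ?invr_ge0 ?(ltW L0)//.
  rewrite mulrC (_ : L^-1 * L^-1 * L^-1 = L^-1 ^+ 3); last by ring.
  by rewrite ler_wpM2r ?exprn_ge0 ?invr_ge0 ?(ltW L0)// step_d3_bound.
- move=> x hx; have : ~~ (c - L < x < c + L).
    by apply: contra hx => /andP[? ?]; apply/andP; split; exact: ltW.
  by move=> /(out L0)/step_derivs_out[_ _ ->]; rewrite mulr0.
- by apply: Rintegral_shift_sqr_le => //; lra.
Qed.

Lemma weight_d3_integral_le s : `|\int[mu]_(x in `[- weight_radius, weight_radius]) (g (x + s) * weight_d3 x)| <=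
  30 * k ^+ 3 * (Num.sqrt (2 * lam) * N) + 30 * k1 ^+ 3 * (Num.sqrt (2 * lam1) * N).
Proof.
have cs : continuous (fun x => g (x + s)) by apply: (continuousT_comp cg); exact: continuous_addr.
have i1 L : mu.-integrable `[- weight_radius, weight_radius] (EFin \o (fun x => g (x + s) * (1 * L^-1 * L^-1 * L^-1 * step_d3 (L^-1 * (x - c))))).
  by apply: continuous_integrable_itv; apply: continuous_mul => //; apply: continuous_scale_aff; exact: step_d3_cont.
have -> : \int[mu]_(x in `[- weight_radius, weight_radius]) (g (x + s) * weight_d3 x) =
   \int[mu]_(x in `[- weight_radius, weight_radius]) (g (x + s) * (1 * lam^-1 * lam^-1 * lam^-1 * step_d3 (lam^-1 * (x - c)))) -
   \int[mu]_(x in `[- weight_radius, weight_radius]) (g (x + s) * (1 * lam1^-1 * lam1^-1 * lam1^-1 * step_d3 (lam1^-1 * (x - c)))).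
  by rewrite -RintegralB//; apply: eq_Rintegral => x _; rewrite -mulrBr.
rewrite (le_trans (ler_normB _ _))// lerD//; apply: conv1 => //.
Qed.

(** The narrow step is used where its slope is bounded below; of the wide one,
    whose slope counts negatively, only the total slope bound 1 / lam1 and the
    full mass of g are used. *)
Lemma weight_d1_integral_ge : k * (27/64 * \int[mu]_(x in `[c - lam / 2, c + lam / 2]) (g x ^+ 2)) - k1 * N ^+ 2 <=
  \int[mu]_(x in `[- weight_radius, weight_radius]) (g x ^+ 2 * weight_d1 x).
Proof.
have [h1 h2] := weight_radius_ge.
have c2 : continuous (fun x => g x ^+ 2) by exact: (continuous_mul cg cg).
have ca (a r : R) : continuous (fun x => g x ^+ 2 * (a * step_d1 (r * (x - c)))).
  by apply: continuous_mul => //; apply: continuous_scale_aff; exact: is_deriv_cont step_d1_deriv.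
have -> : \int[mu]_(x in `[- weight_radius, weight_radius]) (g x ^+ 2 * weight_d1 x) =
   \int[mu]_(x in `[- weight_radius, weight_radius]) (g x ^+ 2 * (1 * k * step_d1 (k * (x - c)))) -
   \int[mu]_(x in `[- weight_radius, weight_radius]) (g x ^+ 2 * (1 * k1 * step_d1 (k1 * (x - c)))).
  rewrite -RintegralB//; [|exact: continuous_integrable_itv..].
  by apply: eq_Rintegral => x _; rewrite -mulrBr.
apply: lerB.
  have l0 := lam0; have l1 := lam01.
  apply: (@le_trans _ _ (\int[mu]_(x in `[c - lam / 2, c + lam / 2]) (g x ^+ 2 * (1 * k * step_d1 (k * (x - c)))))).
    have i27 : mu.-integrable `[c - lam / 2, c + lam / 2] (EFin \o (fun x => 27 / 64 * g x ^+ 2)).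
      by apply: continuous_integrable_itv => x; apply: cvgM; [exact: cvg_cst|exact: c2].
    rewrite -RintegralZl//; last exact: continuous_integrable_itv.
    rewrite -RintegralZl//; apply: le_Rintegral => //.
    - apply: continuous_integrable_itv => x; apply: cvgM; first exact: cvg_cst.
      by apply: cvgM; [exact: cvg_cst|exact: c2].
    - exact: continuous_integrable_itv.
    - move=> x /=; rewrite in_itv/= => /andP[x1 x2].
      rewrite [leRHS](_ : _ = k * (step_d1 (k * (x - c)) * g x ^+ 2)); last by ring.
      rewrite ler_pM2l//; apply: ler_wpM2r; first exact: sqr_ge0.
      have y1 : - (lam / 2) <= x - c by lra.
      have y2 : x - c <= lam / 2 by lra.
      apply: step_d1_ge; rewrite /k; apply/andP; split.
        by rewrite ler_pdivlMl// (_ : lam * (-1 / 2) = - (lam / 2)); [|field].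
      by rewrite ler_pdivrMl// mul1r.
  apply: Rintegral_itv_subset => //; [lra|lra|].
  move=> x; rewrite mul1r mulr_ge0 ?sqr_ge0// mulr_ge0 ?(ltW k0)//.
  by have /andP[] := step_d1_bound (k * (x - c)).
apply: (@le_trans _ _ (k1 * \int[mu]_(x in `[- weight_radius, weight_radius]) (g x ^+ 2))).
  rewrite -RintegralZl//; last exact: continuous_integrable_itv.
  apply: le_Rintegral => //.
  - exact: continuous_integrable_itv.
  - by apply: continuous_integrable_itv => x; apply: cvgM; [exact: cvg_cst|exact: c2].
  - move=> x _; rewrite [leLHS](_ : _ = k1 * (step_d1 (k1 * (x - c)) * g x ^+ 2)); last by ring.
    rewrite ler_pM2l// ler_piMl ?sqr_ge0//.
    by have /andP[] := step_d1_bound (k1 * (x - c)).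
by rewrite ler_pM2l// L2norm_Rintegral.
Qed.

End Bounds.

(** * Functions in H^oo built from the logistic function *)

Section Sigmoid.
Context {R : realType}.
Notation mu := (@lebesgue_measure R).

(** Monotone convergence over [-n, n]: the total mass of S is at most the
    oscillation of its antiderivative.  It gives the square integrability of
    explicit functions. *)
Lemma integral_le_antideriv (S G : R -> R) (K : R) : continuous S -> (forall x, 0 <= S x) ->
  is_deriv G S -> (forall x, 0 <= G x <= K) ->
  (\int[mu]_x (S x)%:E <= K%:E)%E.
Proof.
move=> cS S0 GS GK.
have mS : measurable_fun setT (EFin \o S).
  by apply/measurable_EFinP; exact: continuous_measurable_fun.
rewrite -(@bigcup_itvT R true false).
have nd : nondecreasing_seq (fun n => `[1 *- n, n%:R]%classic : set (measurableTypeR R)).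
  apply/nondecreasing_seqP => n; rewrite subsetEset => x /=.
  rewrite !in_itv/= => /andP[h1 h2]; apply/andP; split.
    by apply: le_trans h1; rewrite lerN2 ler_nat.
  by apply: (le_trans h2); rewrite ler_nat.
have mS' (i : nat) : measurable_fun (`[1 *- i, i%:R]%classic : set (measurableTypeR R)) (EFin \o S).
  exact: (measurable_funS measurableT (@subsetT _ _) mS).
have S0' (i : nat) (x : measurableTypeR R) : `[1 *- i, i%:R]%classic x -> (0 <= (EFin \o S) x)%E.
  by move=> _; rewrite /= lee_fin.
have mI (i : nat) : measurable (`[1 *- i, i%:R]%classic : set (measurableTypeR R)) by [].
have cv := ge0_nondecreasing_set_cvg_integral (mu := mu) nd mI mS' S0'.
have /cvg_lim <- // := cv.
apply: lime_le; first by apply/cvg_ex; eexists; exact: cv.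
apply: nearW => n; rewrite /= -EFin_Rintegral// lee_fin.
have nn : - (n%:R : R) <= n%:R by rewrite (@le_trans _ _ 0)// oppr_le0.
rewrite (Rintegral_FTC GS)//.
by have /andP[a1 a2] := GK n%:R; have /andP[b1 b2] := GK (1 *- n); lra.
Qed.

Lemma integral_sqr_le_antideriv (f S G : R -> R) (K : R) : measurable_fun setT f -> continuous S ->
  (forall x, f x ^+ 2 <= S x) -> is_deriv G S -> (forall x, 0 <= G x <= K) ->
  (\int[mu]_x (f x ^+ 2)%:E <= K%:E)%E.
Proof.
move=> mf cS fS GS GK.
have S0 x : 0 <= S x by rewrite (le_trans (sqr_ge0 _) (fS x)).
apply: le_trans (integral_le_antideriv cS S0 GS GK).
apply: ge0_le_integral => //.
- by move=> x _; rewrite lee_fin sqr_ge0.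
- by apply/measurable_EFinP; apply: measurable_funX.
- by apply/measurable_EFinP; exact: continuous_measurable_fun.
- by move=> x _; rewrite lee_fin.
Qed.

Lemma L2norm_le_sqrt (f : R -> R) (K : R) : 0 <= K ->
  (\int[mu]_x (f x ^+ 2)%:E <= K%:E)%E -> (L2norm f <= (Num.sqrt K)%:E)%E.
Proof.
move=> K0 h; apply/L2norm_leP; first exact: sqrtr_ge0.
by rewrite sqr_sqrtr.
Qed.

Lemma L2_antideriv (f S G : R -> R) (K : R) : measurable_fun setT f -> continuous S ->
  (forall x, f x ^+ 2 <= S x) -> is_deriv G S -> (forall x, 0 <= G x <= K) ->
  f \in L2 R.
Proof.
move=> mf cS fS GS GK; apply: L2_intro => //.
have K0 : 0 <= K by have /andP[a b] := GK 0; exact: le_trans b.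
by apply: le_lt_trans (L2norm_le_sqrt K0 (integral_sqr_le_antideriv mf cS fS GS GK)) _; rewrite ltry.
Qed.

Definition logistic (x : R) : R := (1 + expR (- x))^-1.
Definition dlogistic (x : R) : R := logistic x * (1 - logistic x).

Lemma logistic_den_gt0 (x : R) : 0 < 1 + expR (- x). Proof. by rewrite addr_gt0// expR_gt0. Qed.
Lemma logistic_gt0 x : 0 < logistic x. Proof. by rewrite invr_gt0 logistic_den_gt0. Qed.
Lemma logistic_lt1 x : logistic x < 1.
Proof. by rewrite invf_lt1 ?logistic_den_gt0// ltrDl expR_gt0. Qed.

Lemma logistic_deriv : is_deriv logistic dlogistic.
Proof.
move=> x; have d0 : 1 + expR (- x) != 0 by rewrite gt_eqF ?logistic_den_gt0.
have h : is_derive x (1:R) (fun x : R => 1 + expR (- x)) (- expR (- x)).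
  by apply: is_derive_eq; rewrite /GRing.scale/=; ring.
have := @is_deriveV R (fun x : R => 1 + expR (- x)) x _ _ d0 h; move/is_derive_eq; apply.
by rewrite /GRing.scale/= /dlogistic /logistic; field.
Qed.

Lemma dlogistic_gt0 x : 0 < dlogistic x.
Proof. by rewrite mulr_gt0 ?logistic_gt0// subr_gt0 logistic_lt1. Qed.

Lemma dlogistic_le1 x : dlogistic x <= 1.
Proof. by rewrite mulr_ile1 ?(ltW (logistic_gt0 _)) ?(ltW (logistic_lt1 _)) ?subr_ge0 ?(ltW (logistic_lt1 _))//; have := logistic_gt0 x; lra. Qed.

(** The functions s(1 - s) Q(s), with s the logistic function and Q a polynomial,
    form a class closed under differentiation because s' = s(1 - s);
    dlogistic_polyD is the action of the derivative on Q. *)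
Definition dlogistic_poly (Q : {poly R}) x := dlogistic x * Q.[logistic x].
Definition dlogistic_polyD (Q : {poly R}) : {poly R} := (1 - 2%:P * 'X) * Q + 'X * (1 - 'X) * Q^`().

Lemma horner_is_deriv (Q : {poly R}) : is_deriv (horner Q) (horner Q^`()).
Proof. by move=> x; exact: is_derive_poly. Qed.

Lemma dlogistic_poly_deriv Q : is_deriv (dlogistic_poly Q) (dlogistic_poly (dlogistic_polyD Q)).
Proof.
have d1 : is_deriv dlogistic (fun x => dlogistic x * (1 - 2 * logistic x)).
  have h : is_deriv (fun x => 1 - logistic x) (fun x => - dlogistic x).
    have c : is_deriv (fun _ : R => 1 : R) (fun _ => 0) by move=> x; exact: is_derive_cst.
    by move=> x; have := is_derivB c logistic_deriv x; rewrite sub0r.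
  move=> x; have := is_derivM logistic_deriv h x; move/is_derive_eq; apply.
  by rewrite /dlogistic; ring.
have d2 : is_deriv (fun x => Q.[logistic x]) (fun x => Q^`().[logistic x] * dlogistic x).
  by move=> x; apply: (is_derive1_comp (horner_is_deriv Q (logistic x)) (logistic_deriv x)).
move=> x; have := is_derivM d1 d2 x; move/is_derive_eq; apply.
by rewrite /dlogistic_poly /dlogistic_polyD !(hornerD, hornerM, hornerN, hornerC, hornerX) /dlogistic; ring.
Qed.

Lemma dlogistic_poly_bound (Q : {poly R}) : exists2 C : R, 0 <= C & forall x, `|dlogistic_poly Q x| <= C * dlogistic x.
Proof.
have : exists2 C : R, 0 <= C & forall y, 0 <= y <= 1 -> `|Q.[y]| <= C.
  elim/poly_ind: Q => [|Q c [C C0 h]].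
    by exists 0 => // y _; rewrite horner0 normr0.
  exists (C + `|c|); first by rewrite addr_ge0.
  move=> y y01; rewrite !hornerE (le_trans (ler_normD _ _))// lerD2r normrM.
  move: (y01) => /andP[y0 y1]; rewrite (ger0_norm y0) -[leRHS]mulr1 ler_pM//.
  exact: h.
move=> [C C0 h]; exists C => // x.
rewrite normrM (gtr0_norm (dlogistic_gt0 x)) mulrC ler_wpM2r ?(ltW (dlogistic_gt0 x))//.
by apply: h; rewrite (ltW (logistic_gt0 x)) (ltW (logistic_lt1 x)).
Qed.

Lemma logistic_cont : continuous logistic. Proof. exact: is_deriv_cont logistic_deriv. Qed.
Lemma dlogistic_poly_cont Q : continuous (dlogistic_poly Q). Proof. exact: is_deriv_cont (dlogistic_poly_deriv Q). Qed.
Lemma dlogistic_cont : continuous dlogistic.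
Proof. by apply: continuous_mul; [exact: logistic_cont|move=> x; apply: cvgB; [exact: cvg_cst|exact: logistic_cont]]. Qed.

(** Bumps at scale 1/k have mass C / k, which is small for k large. *)
Lemma dlogistic_antideriv (C k c : R) : 0 < k -> 0 <= C ->
  is_deriv (fun x => C / k * logistic (k * (x - c))) (fun x => C * dlogistic (k * (x - c))) /\
  forall x, 0 <= C / k * logistic (k * (x - c)) <= C / k.
Proof.
move=> k0 C0; split.
  move=> x; have := is_deriv_scale (C / k) k c logistic_deriv x.
  by move/is_derive_eq; apply; field; rewrite gt_eqF.
move=> x; have Ck : 0 <= C / k by rewrite divr_ge0// ltW.
by rewrite mulr_ge0 ?(ltW (logistic_gt0 _))//= ler_piMr// ltW// logistic_lt1.
Qed.

Lemma L2_le_dlogistic (f : R -> R) (C k c : R) : 0 < k -> 0 <= C -> continuous f ->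
  (forall x, `|f x| <= C * dlogistic (k * (x - c))) -> f \in L2 R.
Proof.
move=> k0 C0 cf fC.
have CC : 0 <= C * C by rewrite mulr_ge0.
have [d b] := dlogistic_antideriv c k0 CC.
apply: (L2_antideriv (continuous_measurable_fun cf) _ _ d b).
  apply: continuous_mul; first by move=> x; exact: cvg_cst.
  by apply: continuous_aff; exact: dlogistic_cont.
move=> x; rewrite -real_normK ?num_real//.
have s0 := ltW (dlogistic_gt0 (k * (x - c))).
have := ler_pM (normr_ge0 _) (normr_ge0 _) (fC x) (fC x).
rewrite -expr2 => /le_trans; apply.
rewrite mulrACA ler_wpM2l// ler_piMr// dlogistic_le1//.
Qed.

(** Membership in H^oo without computing the iterated derivatives. *)
Lemma Hinfty_deriv_closed (K : set (R -> R)) :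
  (forall f, K f -> f \in L2 R /\ exists2 f', K f' & is_deriv f f') ->
  forall f, K f -> Hinfty f.
Proof.
move=> hK f Kf n.
have Kn : K (f^`(n)%classic).
  elim: n => [//|n IH]; rewrite derive1nS.
  by have [_ [f' Kf' d]] := hK _ IH; rewrite (is_deriv_derive1 d).
have [h1 [f' _ d]] := hK _ Kn; split => // x.
by have [] := d x.
Qed.

Lemma Hinfty_deriv (f : R -> R) : Hinfty f ->
  [/\ f \in L2 R, is_deriv f f^`()%classic & Hinfty f^`()%classic].
Proof.
move=> hf; split; first exact: (hf 0%N).2.
  by apply: derivable_is_deriv; exact: (hf 0%N).1.
by move=> n; rewrite -derive1Sn; exact: hf.
Qed.

Lemma Hinfty_cont (f : R -> R) : Hinfty f -> continuous f.
Proof. by move=> /Hinfty_deriv[_ d _]; exact: is_deriv_cont d. Qed.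

Lemma L2_lin (a b : R) (f g : R -> R) : f \in L2 R -> g \in L2 R ->
  (fun x => a * f x + b * g x) \in L2 R.
Proof.
move=> fL gL.
have p1 : (1 <= 2%:E :> \bar R)%E by rewrite lee_fin ler1n.
have [z0 hl] := @Lfun_submod_closed _ _ R mu 2%:E p1.
have := hl a f _ fL (hl b g 0 gL z0); set h := (X in X \in _ -> _).
by have -> : h = (fun x => a * f x + b * g x) by apply/funext => x; rewrite /h !fctE addr0.
Qed.

Lemma Hinfty_lin (a b : R) (f g : R -> R) : Hinfty f -> Hinfty g ->
  Hinfty (fun x => a * f x + b * g x).
Proof.
move=> hf hg.
pose K : set (R -> R) := [set h | exists f g, [/\ Hinfty f, Hinfty g & h = (fun x => a * f x + b * g x)]].
apply: (@Hinfty_deriv_closed K); last by exists f, g.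
move=> h [{hf}f [{hg}g [hf hg ->]]].
have [fL df hf'] := Hinfty_deriv hf; have [gL dg hg'] := Hinfty_deriv hg.
split.
  exact: L2_lin.
exists (fun x => a * f^`()%classic x + b * g^`()%classic x).
  by exists f^`()%classic, g^`()%classic.
move=> x; apply: (@is_deriveD _ _ _ (fun x => a * f x) (fun x => b * g x)).
  by apply: is_deriveZ; exact: df.
by apply: is_deriveZ; exact: dg.
Qed.

Lemma Hinfty_dlogistic_poly (k c : R) (Q : {poly R}) : 0 < k -> Hinfty (fun x => dlogistic_poly Q (k * (x - c))).
Proof.
move=> k0.
pose K : set (R -> R) := [set h | exists r Q, h = (fun x => r * dlogistic_poly Q (k * (x - c)))].
apply: (@Hinfty_deriv_closed K); last by exists 1, Q; apply/funext => x; rewrite mul1r.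
move=> h [r [{}Q ->]]; split.
  have [C C0 hC] := dlogistic_poly_bound Q.
  apply: (@L2_le_dlogistic _ (`|r| * C) k c) => //; first by rewrite mulr_ge0.
    apply: continuous_mul; first by move=> x; exact: cvg_cst.
    by apply: continuous_aff; exact: dlogistic_poly_cont.
  by move=> x; rewrite normrM -mulrA ler_wpM2l.
exists (fun x => (r * k) * dlogistic_poly (dlogistic_polyD Q) (k * (x - c))); first by exists (r * k), (dlogistic_polyD Q).
exact: is_deriv_scale (dlogistic_poly_deriv Q).
Qed.

Lemma Hinfty_of_deriv (f f' : R -> R) : f \in L2 R -> is_deriv f f' -> Hinfty f' -> Hinfty f.
Proof.
move=> fL d hf'.
apply: (@Hinfty_deriv_closed [set g | g = f \/ Hinfty g]); last by left.
move=> g [->|hg]; first by split => //; exists f' => //; right.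
have [gL dg hg'] := Hinfty_deriv hg; split => //.
by exists g^`()%classic => //; right.
Qed.

(** A smooth approximation of the indicator of ]a, b], sharp as k grows. *)
Definition logistic_bump (k a b x : R) := logistic (k * (x - a)) - logistic (k * (x - b)).

(** The derivative belongs to the class of dlogistic_poly; square integrability
    of the bump itself comes from a direct comparison with dlogistic. *)
Lemma logistic_bump_Hinfty (k a b : R) : 0 < k -> a <= b -> Hinfty (logistic_bump k a b).
Proof.
move=> k0 ab.
have d : is_deriv (logistic_bump k a b) (fun x => k * dlogistic_poly 1 (k * (x - a)) + (- k) * dlogistic_poly 1 (k * (x - b))).
  move=> x; have := is_derivB (is_deriv_aff k a logistic_deriv) (is_deriv_aff k b logistic_deriv) x.
  by move/is_derive_eq; apply; rewrite /dlogistic_poly -polyC1 !hornerC; ring.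
apply: (@Hinfty_of_deriv _ _ _ d); last by apply: Hinfty_lin; exact: Hinfty_dlogistic_poly.
apply: (@L2_le_dlogistic _ (expR (k * (b - a)) - 1) k b) => //.
- by rewrite subr_ge0 -[leLHS]expR0 ler_expR mulr_ge0 ?(ltW k0)// subr_ge0.
- exact: is_deriv_cont d.
move=> x; rewrite /logistic_bump.
set v := k * (x - b); have -> : k * (x - a) = v + k * (b - a) by rewrite /v; ring.
set h := k * (b - a); have h0 : 0 <= h by rewrite mulr_ge0 ?(ltW k0)// subr_ge0.
rewrite /dlogistic /logistic opprD expRD.
set E := expR (- v); set H := expR (- h).
have -> : expR h = H^-1 by rewrite /H expRN invrK.
have E0 : 0 < E := expR_gt0 _; have H0 : 0 < H := expR_gt0 _.
have H1 : H <= 1 by rewrite expR_le1 oppr_le0.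
have D1 : 0 < 1 + E * H by rewrite addr_gt0// mulr_gt0.
have D2 : 0 < 1 + E by rewrite addr_gt0.
have e : (1 + E * H)^-1 - (1 + E)^-1 = E * (1 - H) / ((1 + E * H) * (1 + E)).
  by field; rewrite !gt_eqF.
rewrite e ger0_norm; last first.
  by apply: divr_ge0; rewrite mulr_ge0 ?(ltW E0) ?(ltW D1) ?(ltW D2) ?subr_ge0.
have -> : (H^-1 - 1) * ((1 + E)^-1 * (1 - (1 + E)^-1)) = E * (1 - H) / ((H * (1 + E)) * (1 + E)).
  by field; rewrite !gt_eqF.
rewrite ler_wpM2l ?mulr_ge0 ?subr_ge0 ?(ltW E0)// lef_pV2 ?posrE ?mulr_gt0//.
by rewrite ler_wpM2r ?(ltW D2)//; nra.
Qed.

End Sigmoid.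

(** * Density of H^oo in L2 *)

Section Density.
Context {R : realType}.
Notation mu := (@lebesgue_measure R).

Lemma L2norm_scale_le (a e : R) (f : R -> R) : 0 <= e -> measurable_fun setT f ->
  (L2norm f <= e%:E)%E -> (L2norm (fun x => a * f x)%R <= (`|a| * e)%:E)%E.
Proof.
move=> e0 mf /(L2norm_leP _ e0) h; apply/L2norm_leP; first by rewrite mulr_ge0.
under eq_integral do rewrite exprMn EFinM.
rewrite ge0_integralZl_EFin//; last 3 first.
- by move=> x _; rewrite lee_fin sqr_ge0.
- by apply/measurable_EFinP; exact: measurable_funX.
- by rewrite sqr_ge0.
rewrite exprMn real_normK ?num_real// [leRHS]EFinM.
apply: lee_pmul => //; first by rewrite lee_fin sqr_ge0.
by apply: integral_ge0 => x _; rewrite lee_fin sqr_ge0.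
Qed.

(** Membership in the L2-closure of H^oo.  The closure is a vector space closed
    under L2-limits, so density is proved by enlarging it step by step:
    indicators, continuous functions cut off to an interval, bounded functions
    of bounded support, and finally all of L2. *)
Definition Hinfty_approx (f : R -> R) := measurable_fun setT f /\
  forall e : R, 0 < e -> exists2 phi, Hinfty phi & (L2norm (phi \- f)%R <= e%:E)%E.

Lemma Hinfty_measurable (f : R -> R) : Hinfty f -> measurable_fun setT f.
Proof. by move=> hf; apply: continuous_measurable_fun; exact: Hinfty_cont. Qed.

Lemma Hinfty_approx_lin (a b : R) (f g : R -> R) : Hinfty_approx f -> Hinfty_approx g ->
  Hinfty_approx (fun x => a * f x + b * g x).
Proof.
move=> [mf hf] [mg hg]; split.
  by apply: measurable_funD; apply: measurable_funM => //; exact: measurable_cst.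
move=> e e0.
(* The summand 1 only keeps the divisor positive. *)
pose c := `|a| + `|b| + 1; have c0 : 0 < c by rewrite ltr_wpDl ?addr_ge0.
have ec : 0 < e / c by rewrite divr_gt0.
have [p Hp np] := hf _ ec; have [q Hq nq] := hg _ ec.
exists (fun x => a * p x + b * q x); first exact: Hinfty_lin.
have mp := Hinfty_measurable Hp; have mq := Hinfty_measurable Hq.
have -> : ((fun x => a * p x + b * q x) \- (fun x => a * f x + b * g x))%R =
   ((fun x => a * (p \- f) x) \+ (fun x => b * (q \- g) x))%R.
  by apply/funext => x /=; ring.
have mpf : measurable_fun setT (p \- f) by exact: measurable_funB.
have mqg : measurable_fun setT (q \- g) by exact: measurable_funB.
apply: (le_trans (L2norm_triangle _ _)).
- by apply: measurable_funM => //; exact: measurable_cst.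
- by apply: measurable_funM => //; exact: measurable_cst.
apply: (le_trans (leeD (L2norm_scale_le a (ltW ec) mpf np) (L2norm_scale_le b (ltW ec) mqg nq))).
rewrite -EFinD lee_fin -mulrDl mulrC mulrAC ler_pdivrMr// ler_pM2l//.
by rewrite /c lerDl.
Qed.

Lemma Hinfty_approx_lim (f : R -> R) : measurable_fun setT f ->
  (forall e : R, 0 < e -> exists2 g, Hinfty_approx g & (L2norm (g \- f)%R <= e%:E)%E) -> Hinfty_approx f.
Proof.
move=> mf h; split => // e e0.
have e2 : 0 < e / 2 by rewrite divr_gt0.
have [g [mg hg] gf] := h _ e2; have [p Hp pg] := hg _ e2.
exists p => //; have mp := Hinfty_measurable Hp.
have -> : (p \- f)%R = ((p \- g) \+ (g \- f))%R by apply/funext => x /=; ring.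
apply: (le_trans (L2norm_triangle _ _)); [exact: measurable_funB..|].
by rewrite [e]splitr EFinD leeD.
Qed.

Definition indic_oc (a b x : R) : R := (a < x <= b)%R%:R.

Lemma indic_ocE (a b : R) : indic_oc a b = \1_`]a, b]%classic.
Proof.
apply/funext => x; rewrite /indic_oc indicE.
by have -> : (a < x <= b) = (x \in `]a, b]%classic) by apply/idP/idP; rewrite inE/= in_itv.
Qed.

Lemma indic_oc_measurable (a b : R) : measurable_fun setT (indic_oc a b).
Proof. by rewrite indic_ocE; exact: measurable_indic. Qed.

(** The smaller of s and 1 - s is at most 2 s (1 - s), as the other one is at
    least 1/2. *)
Lemma logistic_heaviside (y : R) : `|logistic y - (0 < y)%R%:R| <= 2 * dlogistic y.
Proof.
have h1 := logistic_gt0 y; have h2 := logistic_lt1 y.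
have [y0|y0] := ltP 0 y.
  have hs : 2^-1 <= logistic y.
    rewrite /logistic lef_pV2 ?posrE ?logistic_den_gt0//.
    have : expR (- y) <= 1 by rewrite expR_le1 oppr_le0 ltW.
    lra.
  rewrite -[true%:R]/(1 : R).
  have : 0 <= (1 - logistic y) * (logistic y - 2^-1) by rewrite mulr_ge0 ?subr_ge0// ltW.
  by rewrite /dlogistic ler0_norm; [nra|rewrite subr_le0 ltW].
have hs : logistic y <= 2^-1.
  rewrite /logistic lef_pV2 ?posrE ?logistic_den_gt0//.
  have : 1 <= expR (- y) by rewrite -expR0 ler_expR oppr_ge0.
  lra.
rewrite -[false%:R]/(0 : R).
have : 0 <= logistic y * (2^-1 - logistic y) by rewrite mulr_ge0 ?subr_ge0// ltW.
by rewrite subr0 /dlogistic ger0_norm ?(ltW h1)//; nra.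
Qed.

(** The squared error is dominated by two bumps of mass 8 / k each. *)
Lemma Hinfty_approx_indic (a b : R) : a <= b -> Hinfty_approx (indic_oc a b).
Proof.
move=> ab; split; first exact: indic_oc_measurable.
(* The value of k for which 8 / k + 8 / k = e^2. *)
move=> e e0; pose k := 16 / e ^+ 2.
have e20 : 0 < e ^+ 2 by rewrite exprn_gt0.
have k0 : 0 < k by rewrite divr_gt0.
exists (logistic_bump k a b); first exact: logistic_bump_Hinfty.
have [da ba] := @dlogistic_antideriv R 8 k a k0 (ler0n _ _).
have [db bb] := @dlogistic_antideriv R 8 k b k0 (ler0n _ _).
have dab : is_deriv (fun x => 8 / k * logistic (k * (x - a)) + 8 / k * logistic (k * (x - b)))
    (fun x => 8 * dlogistic (k * (x - a)) + 8 * dlogistic (k * (x - b))).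
  by move=> x; exact: is_deriveD (da x) (db x).
have cs (c : R) : continuous (fun x => 8 * dlogistic (k * (x - c))).
  apply: continuous_mul; first by move=> x; exact: cvg_cst.
  by apply: continuous_aff; exact: dlogistic_cont.
have mB : measurable_fun setT (logistic_bump k a b).
  by apply: Hinfty_measurable; exact: logistic_bump_Hinfty.
have := @integral_sqr_le_antideriv R (logistic_bump k a b \- indic_oc a b) _ _ (e ^+ 2) _ _ _ dab _.
move=> H; apply/L2norm_leP; first exact: ltW.
apply: H.
- by apply: measurable_funB => //; exact: indic_oc_measurable.
- by move=> x; apply: cvgD; exact: cs.
- move=> x; rewrite /logistic_bump /=.
  have -> : indic_oc a b x = (0 < k * (x - a))%R%:R - (0 < k * (x - b))%R%:R.
    have kc (c : R) : (0 < k * (x - c)) = (c < x) by rewrite (pmulr_rgt0 _ k0) subr_gt0.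
    rewrite !kc /indic_oc.
    have [xb|xb] := leP x b; first by rewrite andbT subr0.
    by rewrite andbF (le_lt_trans ab xb) subrr.
  have ha := logistic_heaviside (k * (x - a)); have hb := logistic_heaviside (k * (x - b)).
  set p := logistic (k * (x - a)) in ha *; set p' := logistic (k * (x - b)) in hb *.
  set q := (_ < k * (x - a))%R%:R in ha *; set q' := (_ < k * (x - b))%R%:R in hb *.
  have sa1 := dlogistic_le1 (k * (x - a)); have sa0 := ltW (dlogistic_gt0 (k * (x - a))).
  have sb1 := dlogistic_le1 (k * (x - b)); have sb0 := ltW (dlogistic_gt0 (k * (x - b))).
  set s := dlogistic _ in ha sa0 sa1 *; set s' := dlogistic _ in hb sb0 sb1 *.
  have h1 : (p - q) ^+ 2 <= 4 * s.
    rewrite -real_normK ?num_real//.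
    have := ler_pM (normr_ge0 _) (normr_ge0 _) ha ha.
    by rewrite -expr2 => /le_trans; apply; nra.
  have h2 : (p' - q') ^+ 2 <= 4 * s'.
    rewrite -real_normK ?num_real//.
    have := ler_pM (normr_ge0 _) (normr_ge0 _) hb hb.
    by rewrite -expr2 => /le_trans; apply; nra.
  have := sqr_ge0 (p - q + (p' - q')); nra.
- move=> x; have /andP[a1 a2] := ba x; have /andP[b1 b2] := bb x.
  have -> : e ^+ 2 = 8 / k + 8 / k by rewrite /k; field; rewrite gt_eqF.
  by rewrite addr_ge0// lerD.
Qed.

Lemma uniform_continuity_itv (g : R -> R) (a b e : R) : continuous g -> 0 < e ->
  exists2 d : R, 0 < d & forall x y, a <= x <= b -> `|y - x| < d -> `|g y - g x| <= e.
Proof.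
move=> cg e0.
have := (@compact_near_coveringP R `[a, b]%classic).1 (@segment_compact R a b).
move=> /(_ R (0 : R)^'+ (fun d x => forall y, `|y - x| < d -> `|g y - g x| <= e)).
move=> hn.
have : \forall d \near (0 : R)^'+, `[a, b]%classic `<=`
    (fun x => forall y, `|y - x| < d -> `|g y - g x| <= e).
  apply: hn => x _.
  have e2 : 0 < e / 2 by rewrite divr_gt0.
  have /cvgrPdist_lt/(_ _ e2) := cg x.
  move=> [r /= r0 hr].
  have r2 : 0 < r / 2 by rewrite divr_gt0.
  exists (ball x (r / 2), [set d | d < r / 2]).
    by split; [exact: nbhsx_ballx|exact: nbhs_right_lt].
  move=> [x' d] /= []; rewrite /ball/= => xx' dr y yx'.
  have h1 := hr x' (ltac:(rewrite /=; lra)).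
  have h2 : `|g x - g y| < e / 2.
    apply: hr => /=; have := ler_distD x' x y; rewrite (distrC x' y); lra.
  have := ler_distD (g x) (g y) (g x'); rewrite (distrC (g y) (g x)); lra.
move=> [r /= r0 hr]; exists (r / 2); first by rewrite divr_gt0.
move=> x y xab yx; apply: (hr (r / 2)) yx => //=.
  by rewrite sub0r normrN ger0_norm; lra.
by rewrite divr_gt0.
Qed.

Lemma L2norm_le_indic (h : R -> R) (a b e : R) : a <= b -> 0 <= e -> measurable_fun setT h ->
  (forall x, `|h x| <= e * indic_oc a b x) -> (L2norm h <= (e * Num.sqrt (b - a))%:E)%E.
Proof.
move=> ab e0 mh hh; apply/L2norm_leP; first by rewrite mulr_ge0 ?sqrtr_ge0.
apply: (@le_trans _ _ (\int[mu]_x ((e ^+ 2)%R%:E * (\1_`]a, b]%classic x)%R%:E))%E).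
  apply: ge0_le_integral => //.
  - by move=> x _; rewrite lee_fin sqr_ge0.
  - by apply/measurable_EFinP; exact: measurable_funX.
  - apply/measurable_EFinP; apply: measurable_funM; first exact: measurable_cst.
    exact: measurable_indic.
  - move=> x _; rewrite -EFinM lee_fin -real_normK ?num_real//.
    have := ler_pM (normr_ge0 _) (normr_ge0 _) (hh x) (hh x).
    rewrite -expr2 => /le_trans; apply.
    by rewrite -indic_ocE /indic_oc; case: (a < x <= b); rewrite ?mulr1 ?mulr0 ?mul0r ?expr2.
rewrite ge0_integralZl_EFin ?sqr_ge0//; last first.
  by apply/measurable_EFinP; exact: measurable_indic.
have E : mu (`]a, b]%classic : set R) = (b - a)%:E.
  rewrite lebesgue_measure_itv/= lte_fin -EFinB.
  by move: ab; rewrite le_eqVlt => /predU1P[->|->//]; rewrite ltxx subrr.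
rewrite integral_indic// setIT.
apply: (@le_trans _ _ ((e ^+ 2)%:E * (b - a)%:E)%E); first by rewrite -E; exact: lexx.
by rewrite -EFinM lee_fin exprMn sqr_sqrtr ?subr_ge0.
Qed.

(** Uniform continuity gives a step function close to g; it is built from the
    right end of the interval, one step of length d / 2 at a time. *)
Lemma Hinfty_approx_cont (g : R -> R) (a b : R) : continuous g -> a <= b ->
  Hinfty_approx (fun x => g x * indic_oc a b x).
Proof.
move=> cg ab.
have mg : measurable_fun setT (fun x => g x * indic_oc a b x).
  by apply: measurable_funM; [exact: continuous_measurable_fun|exact: indic_oc_measurable].
apply: Hinfty_approx_lim => // e e0.
pose c := Num.sqrt (b - a) + 1; have c0 : 0 < c by rewrite ltr_wpDl ?sqrtr_ge0.
have ec : 0 < e / c by rewrite divr_gt0.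
have [d d0 hd] := uniform_continuity_itv a b cg ec.
(* Induction on the number n of steps of length d / 2 that cover [a', b]. *)
have H : forall n a', a <= a' <= b -> b - a' <= n%:R * (d / 2) ->
    exists2 h, Hinfty_approx h & forall x, `|h x - g x * indic_oc a' b x| <= (e / c) * indic_oc a' b x.
  elim=> [|n IH] a' /andP[aa' a'b].
    rewrite mul0r => hb; exists (fun x => 0 * indic_oc a b x + 0 * indic_oc a b x).
      by apply: Hinfty_approx_lin; exact: Hinfty_approx_indic.
    move=> x; have -> : indic_oc a' b x = 0.
      by rewrite /indic_oc; case: (ltP a' x) => //= h; case: (leP x b) => //= ?; lra.
    by rewrite !(mul0r, mulr0) addr0 subrr normr0.
  move=> hb; pose a2 := Num.min b (a' + d / 2).
  have a2b : a2 <= b by rewrite ge_min lexx.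
  have a'a2 : a' <= a2 by rewrite le_min a'b/=; lra.
  have a2d : a2 - a' <= d / 2 by rewrite lerBlDl ge_min lexx orbT.
  have [||h Ah hh] := IH a2.
  - by rewrite a2b (le_trans aa').
  - rewrite /a2; have [h|h] := leP b (a' + d / 2).
      by rewrite subrr mulr_ge0// divr_ge0// ltW.
    by move: hb; rewrite -natr1 mulrDl mul1r; lra.
  exists (fun x => g a' * indic_oc a' a2 x + 1 * h x).
    by apply: Hinfty_approx_lin => //; exact: Hinfty_approx_indic.
  move=> x; have := hh x; rewrite mul1r.
  have [xa|xa] := leP x a'.
    have -> : indic_oc a' a2 x = 0 by rewrite /indic_oc ltNge xa.
    have -> : indic_oc a' b x = 0 by rewrite /indic_oc ltNge xa.
    have -> : indic_oc a2 b x = 0 by rewrite /indic_oc ltNge (le_trans xa).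
    by rewrite !mulr0 add0r.
  have [xa2|xa2] := leP x a2.
    have -> : indic_oc a' a2 x = 1 by rewrite /indic_oc xa xa2.
    have -> : indic_oc a' b x = 1 by rewrite /indic_oc xa (le_trans xa2).
    have -> : indic_oc a2 b x = 0 by rewrite /indic_oc ltNge xa2.
    rewrite !mulr0 subr0 normr_le0 => /eqP ->; rewrite addr0 !mulr1 distrC.
    by apply: hd; [rewrite aa' a'b|rewrite ger0_norm; lra].
  have -> : indic_oc a' a2 x = 0 by rewrite /indic_oc [x <= _]leNgt xa2 andbF.
  have -> : indic_oc a' b x = indic_oc a2 b x by rewrite /indic_oc xa xa2.
  by rewrite mulr0 add0r.
pose n := Num.truncn ((b - a) / (d / 2)).
have [||h Ah hh] := H n.+1 a.
- by rewrite lexx ab.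
- have d2 : 0 < d / 2 by rewrite divr_gt0.
  by rewrite -ler_pdivrMr// ltW// truncnS_gt.
exists h => //.
have mh : measurable_fun setT h by case: Ah.
apply: (le_trans (@L2norm_le_indic _ a b (e / c) ab (ltW ec) _ hh)).
  by apply: measurable_funB.
rewrite lee_fin mulrAC ler_pdivrMr// ler_pM2l//.
by rewrite /c lerDl.
Qed.

End Density.

Section Approximation.
Context {R : realType}.
Notation mu := (@lebesgue_measure R).

Lemma cvge0_exists_lt (u : nat -> \bar R) (c : R) : 0 < c -> u n @[n --> \oo] --> 0%E ->
  exists n, (u n < c%:E)%E.
Proof.
move=> c0 /fine_cvgP[[n1 _ h1] h2].
have [n2 _ h3] := cvgr_lt 0 h2 _ c0.
exists (maxn n1 n2); have f := h1 _ (leq_maxl n1 n2).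
have g := h3 _ (leq_maxr n1 n2).
by rewrite /= in f g; rewrite -(fineK f) lte_fin.
Qed.

(** Continuous functions are dense in L1 of an interval.  Clamping the
    approximant to [-N, N] does not move it away from F and bounds the
    error by 2 N, so the squared error is at most 2 N times the L1-error. *)
Lemma Hinfty_approx_bounded (F : R -> R) (N : R) : 0 < N -> measurable_fun setT F ->
  (forall x, `|F x| <= N * indic_oc (- N) N x) -> Hinfty_approx F.
Proof.
move=> N0 mF FN; apply: Hinfty_approx_lim => // e e0.
have NN : - N <= N by lra.
pose E : set R := `]- N, N]%classic.
have mE : measurable (E : set (measurableTypeR R)) by exact: measurable_itv.
have Efin : (mu E < +oo)%E.
  by rewrite lebesgue_measure_itv/=; case: ifPn => // _; rewrite -EFinB ltry.
have iF : mu.-integrable E (EFin \o F).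
  apply: measurable_bounded_integrable => //; first exact: measurable_funTS.
  exists N; split; first exact: num_real.
  move=> y Ny x _ /=; apply: (le_trans _ (ltW Ny)); apply: (le_trans (FN x)).
  by rewrite ler_piMr ?(ltW N0)// /indic_oc; case: (_ < _ <= _).
have [g_ [cg_ ig_ hg_]] := approximation_continuous_integrable mE Efin iF.
(* The L1-error that gives a squared L2-error of e^2. *)
have e20 : 0 < e ^+ 2 / (2 * N) by rewrite divr_gt0 ?exprn_gt0 ?mulr_gt0.
have [n hn] : exists n, (\int[mu]_(z in E) `|(F z - g_ n z)%:E| < (e ^+ 2 / (2 * N))%:E)%E.
  exact: cvge0_exists_lt e20 hg_.
pose g := g_ n; have cg : continuous g := cg_ n.
pose h x := N * clamp (g x / N).
have ch : continuous h.
  apply: continuous_mul; first by move=> x; exact: cvg_cst.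
  apply: (continuousT_comp clamp_cont) => x; apply: cvgM; [exact: cg|exact: cvg_cst].
exists (fun x => h x * indic_oc (- N) N x); first exact: Hinfty_approx_cont.
have mh : measurable_fun setT (fun x => h x * indic_oc (- N) N x).
  by apply: measurable_funM; [exact: continuous_measurable_fun|exact: indic_oc_measurable].
apply/L2norm_leP; first exact: ltW.
have F_clamp x : F x = N * clamp (F x / N).
  have : `|F x| <= N.
    by apply: (le_trans (FN x)); rewrite ler_piMr ?(ltW N0)// /indic_oc; case: (_ < _ <= _).
  rewrite ler_norml => /andP[h1 h2].
  rewrite clamp_id; first by field; rewrite gt_eqF.
  by rewrite ler_pdivlMr// mulN1r h1 ler_pdivrMr// mul1r.
have Nc y : `|N * clamp y| <= N.
  have := clampP y; rewrite -ler_norml => hc.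
  by rewrite normrM (gtr0_norm N0) ler_piMr// ltW.
have hF x : (h x - F x) ^+ 2 <= 2 * N * `|F x - g x|.
  rewrite -real_normK ?num_real// expr2 ler_pM//.
    rewrite {1}F_clamp (le_trans (ler_normB _ _))//.
    by rewrite mulr_natl mulr2n lerD// Nc.
  rewrite {1}F_clamp /h -mulrBr normrM (gtr0_norm N0) distrC.
  have := clamp_lip (F x / N) (g x / N).
  move=> hc; apply: (@le_trans _ _ (N * `|F x / N - g x / N|)); first by rewrite ler_pM2l.
  by rewrite -mulrBl normrM normfV (gtr0_norm N0) mulrCA mulfV ?mulr1// gt_eqF.
have mD : measurable_fun setT (fun x => h x * indic_oc (- N) N x - F x) by exact: measurable_funB.
have mg : measurable_fun setT (fun x => F x - g x).
  by apply: measurable_funB => //; exact: continuous_measurable_fun.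
have out x : ~ E x -> h x * indic_oc (- N) N x - F x = 0.
  move=> Ex; have i0 : indic_oc (- N) N x = 0.
    rewrite /indic_oc; have [hx|//] := boolP (- N < x <= N).
    by exfalso; apply: Ex; rewrite /E /= in_itv /=.
  have := FN x; rewrite i0 !mulr0 normr_le0 => /eqP ->.
  by rewrite subrr.
have inE1 x : E x -> indic_oc (- N) N x = 1.
  by rewrite /E/= in_itv/= /indic_oc => ->.
have -> : (\int[mu]_x (((fun x => h x * indic_oc (- N) N x) \- F)%R x ^+ 2)%:E =
    \int[mu]_(x in E) ((h x - F x) ^+ 2)%:E)%E.
  rewrite [RHS]integral_mkcond; apply: eq_integral => x _; rewrite patchE /=.
  case: ifPn => xE.
    by rewrite inE in xE; rewrite inE1// mulr1.
  rewrite out ?expr0n//; by move=> Ex; move: xE; rewrite notin_setE.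
have m1 : measurable_fun setT (EFin \o (fun x => (h x - F x) ^+ 2)).
  apply/measurable_EFinP; apply: measurable_funX.
  by apply: measurable_funB => //; exact: continuous_measurable_fun.
have m3 : measurable_fun setT (fun x => `|(F x - g x)%:E|%E).
  by apply/measurable_EFinP; exact: measurableT_comp.
have m2 : measurable_fun setT (fun x => ((2 * N)%:E * `|(F x - g x)%:E|)%E).
  apply/measurable_EFinP; apply: measurable_funM; first exact: measurable_cst.
  exact: measurableT_comp.
apply: (@le_trans _ _ (\int[mu]_(x in E) ((2 * N)%:E * `|(F x - g x)%:E|))%E).
  apply: ge0_le_integral => //.
  - by move=> x _; rewrite lee_fin sqr_ge0.
  - exact: (measurable_funS measurableT (@subsetT _ _) m1).
  - exact: (measurable_funS measurableT (@subsetT _ _) m2).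
  - by move=> x _; rewrite -EFinM lee_fin.
rewrite ge0_integralZl_EFin//; last 2 first.
- exact: (measurable_funS measurableT (@subsetT _ _) m3).
- by rewrite mulr_ge0// ltW.
have N20 : 0 < 2 * N by rewrite mulr_gt0.
have -> : ((e ^+ 2)%:E = (2 * N)%:E * (e ^+ 2 / (2 * N))%:E)%E.
  by rewrite -EFinM; congr EFin; field; rewrite gt_eqF.
by apply: lee_pmul => //; [rewrite lee_fin ltW|exact: integral_ge0|exact: ltW].
Qed.

(** Truncate both the argument and the values of f at n, and use dominated
    convergence. *)
Lemma Hinfty_dense (f : R -> R) : f \in L2 R -> Hinfty_approx f.
Proof.
move=> fL; have mf := L2_measurable fL.
apply: Hinfty_approx_lim => // e e0.
pose A n : set R := `]- n.+1%:R, n.+1%:R]%classic `&` (f @^-1` `[- n.+1%:R, n.+1%:R]).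
have mA n : measurable (A n).
  apply: measurableI => //; rewrite -[X in measurable X]setTI; exact: mf.
pose fn n x := f x * \1_(A n) x.
have mfn n : measurable_fun setT (fn n).
  by apply: measurable_funM => //; exact: measurable_indic.
have Afn n : Hinfty_approx (fn n).
  apply: (@Hinfty_approx_bounded _ n.+1%:R) => // x.
  rewrite /fn indicE; have [|] := boolP (x \in A n).
    rewrite inE /A /= !in_itv/= => -[h1 h2].
    by rewrite mulr1 /indic_oc h1 mulr1 ler_norml.
  by move=> _; rewrite mulr0 normr0 mulr_ge0.
have ii : mu.-integrable setT (EFin \o (fun x => f x ^+ 2)) by exact: Lfun2_integrable_sqr.
have mfe n : measurable_fun setT (EFin \o (fun x => (fn n x - f x) ^+ 2)).
  by apply/measurable_EFinP; apply: measurable_funX; exact: measurable_funB.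
have [] := @dominated_convergence _ _ _ mu setT measurableT
    (fun n => EFin \o (fun x => (fn n x - f x) ^+ 2)) (cst 0%E)
    (EFin \o (fun x => f x ^+ 2)) mfe _ _ ii _.
- exact: measurable_cst.
- apply: aeW => x _.
  apply: (@cvg_near_cst _ _ (0 : \bar R) (fun n => ((fn n x - f x) ^+ 2)%:E)).
  near=> n; rewrite /fn indicE mem_set; first by rewrite mulr1 subrr expr0n.
  have h1 : `|x| < n%:R by near: n; exact: nbhs_infty_gtr.
  have h2 : `|f x| < n%:R by near: n; exact: nbhs_infty_gtr.
  have nn : n%:R < n.+1%:R :> R by rewrite ltr_nat.
  split; rewrite /= in_itv/=.
    move: h1; rewrite ltr_norml => /andP[a b]; apply/andP; split; lra.
  move: h2; rewrite ltr_norml => /andP[a b]; apply/andP; split; lra.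
- apply: aeW => x n _; rewrite /= /fn indicE lee_fin.
  case: (x \in A n) => /=; first by rewrite mulr1 subrr expr0n normr0 sqr_ge0.
  by rewrite mulr0 sub0r sqrrN ger0_norm ?sqr_ge0.
move=> _ _; rewrite integral0 => hc.
have e20 : 0 < e ^+ 2 by rewrite exprn_gt0.
have [m hm] := cvge0_exists_lt e20 hc.
exists (fn m); first exact: Afn.
by apply/L2norm_leP; exact: ltW.
Unshelve. all: by end_near. Qed.

End Approximation.

(** * The virial inequality on a time interval *)

Section Interval.
Context {R : realType}.
Notation mu := (@lebesgue_measure R).
Context (delta : R).
Context (delta0 : 0 < delta).

(** The mean value theorem for J on [T, T + tau]: the growth of J is at
    least tau times the lower bound for J', and at most twice the bound for
    |J|. *)
Lemma virial_interval_le (phi : R -> R) (v : R -> R -> R) (c lam lam1 T tau N kap B : R) :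
  smooth_ILW_solution delta phi v -> 0 < lam -> lam <= lam1 -> 0 < tau -> 0 < N ->
  (forall t, T <= t <= T + tau -> (L2norm (v t) <= N%:E)%E) ->
  (forall t, T <= t <= T + tau ->
     kap <= \int[mu]_(x in `[c - lam / 2, c + lam / 2]) (v t x ^+ 2)) ->
  30 * lam^-1 ^+ 3 * (Num.sqrt (2 * lam) * N) +
    30 * lam1^-1 ^+ 3 * (Num.sqrt (2 * lam1) * N) <= B ->
  tau * (2^-1 * (lam^-1 * (27 / 64 * kap) - lam1^-1 * N ^+ 2) - B * kernel_mass delta / delta)
   <= 4 * (Num.sqrt (2 * lam1) * N).
Proof.
move=> hv lam0 lam01 tau0 N0 vN vk hBB.
have cv t : continuous (v t).
  exact: (smooth_continuous hv (k := 0) (t := t)).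
pose J := weighted_integral v (weight c lam lam1) (weight_radius c lam1).
have lam10 : 0 < lam1 by exact: lt_le_trans lam01.
have main t : T <= t <= T + tau -> derivable J t 1 /\
   2^-1 * (lam^-1 * (27 / 64 * kap) - lam1^-1 * N ^+ 2) - B * kernel_mass delta / delta <= J^`()%classic t.
  move=> tT; have hB s : `|\int[mu]_(x in `[- weight_radius c lam1, weight_radius c lam1]) (v t (x + s) * weight_d3 c lam lam1 x)| <= B.
    exact: le_trans (weight_d3_integral_le c lam0 lam01 (cv t) N0 (vN t tT) s) hBB.
  have [dJ hJ] := virial_inequality delta0 hv (weight_radius_ge0 c lam0 lam01) (weight_deriv c lam lam1)
    (weight_d1_deriv c lam lam1) (weight_d2_deriv c lam lam1) (@weight_d3_cont R c lam lam1)
    (weight_bound c lam lam1) (weight_d2_bound c lam0 lam01) (weight_end c lam0 lam01)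
    (weight_d2_end c lam0 lam01) hB.
  split => //; apply: le_trans hJ; rewrite lerD2r ler_pM2l ?invr_gt0//.
  apply: le_trans (weight_d1_integral_ge c lam0 lam01 (cv t) (vN t tT)).
  rewrite lerD2r ler_pM2l ?invr_gt0// ler_pM2l; first exact: vk.
  by rewrite divr_gt0.
have JN t : T <= t <= T + tau -> `|J t| <= 2 * (Num.sqrt (2 * lam1) * N).
  by move=> tT; exact: (weight_integral_le c lam0 lam01 (cv t) N0 (vN t tT)).
have TT : T <= T + tau by rewrite lerDl ltW.
have JT := JN T (ltac:(by rewrite lexx TT)).
have JTt := JN (T + tau) (ltac:(by rewrite lexx TT)).
have [||s sT] := @MVT_segment R J J^`()%classic T (T + tau) TT.
- move=> s; rewrite in_itv/= => /andP[s1 s2].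
  have [d _] := main s (ltac:(by rewrite (ltW s1) (ltW s2))).
  by split; [exact: d|rewrite derive1E].
- apply: derivable_within_continuous => s; rewrite in_itv/= => sT.
  by have [] := main s sT.
rewrite in_itv/= in sT; have [_ hs] := main s sT.
have -> : T + tau - T = tau by ring.
move=> e; apply: (@le_trans _ _ (J^`()%classic s * tau)).
  by rewrite mulrC ler_pM2r.
rewrite -e; move: JT JTt; rewrite !ler_norml => /andP[a1 a2] /andP[b1 b2]; lra.
Qed.

(** A null set of times contains no interval, so every time is a limit of times
    at which the bound holds, and continuity transfers the bound, up to 1. *)
Lemma L2_bounded_all (u : R -> R -> R) : L2_continuous setT u -> L2_bounded u ->
  exists2 M : R, 0 < M & forall t, (L2norm (u t) <= M%:E)%E.
Proof.
move=> [uL uc] [M [A [mA A0 hA]]].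
exists (`|M| + 1); first by rewrite ltr_wpDl.
move=> t.
have := uc t I; move=> /fine_cvgP[[r1 /= r10 h1] h2].
have /cvgrPdist_lt/(_ 1 ltr01) := h2.
move=> [r2 /= r20 h2']; pose r := Num.min r1 r2.
have r0 : 0 < r by rewrite lt_min r10.
have [s [st hs]] : exists s, `|t - s| < r /\ (L2norm (u s) <= M%:E)%E.
  apply: contrapT => /forallNP hn.
  have sub : ball t r `<=` A.
    move=> s ts; apply: hA => /= hs; apply: (hn s); split => //.
  have mb : measurable (ball t r : set (measurableTypeR R)) by exact: measurable_ball.
  have : (mu (ball t r : set R) <= mu A)%E by apply: le_measure => //; rewrite inE.
  rewrite A0 lebesgue_measure_ball ?(ltW r0)// lee_fin leNgt => /negP; apply.
  by rewrite pmulrn_lgt0.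
move: st; rewrite lt_min => /andP[st1 st2].
have f1 := h1 s st1 I; have f2 := h2' s st2 I; rewrite /= in f1 f2.
rewrite sub0r normrN in f2.
have mus : measurable_fun setT (u s) by apply: L2_measurable; exact: uL.
have mut : measurable_fun setT (u t) by apply: L2_measurable; exact: uL.
apply: (le_trans (@L2norm_le_near _ (u t) (u s) `|M| 1 _ _ _ _)) => //.
  by apply: (le_trans hs); rewrite lee_fin ler_norm.
by rewrite L2normB -(fineK f1) lee_fin; apply: le_trans (ltW f2); exact: ler_norm.
Qed.

Lemma L2norm_ae_sub (f f' g g' : R -> R) : f = f' %[ae mu] -> g = g' %[ae mu] ->
  f \in L2 R -> f' \in L2 R -> g \in L2 R -> g' \in L2 R ->
  L2norm (f \- g)%R = L2norm (f' \- g')%R.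
Proof.
move=> ff gg /L2_measurable mf /L2_measurable mf' /L2_measurable mg /L2_measurable mg'.
apply: L2norm_ae_eq; [|exact: measurable_funB..].
pose F := ae_filter_ringOfSetsType mu.
have := @filterI _ _ F _ _ ff gg.
by apply: ae_imply_all => x [h1 h2] /= _; rewrite h1 ?h2.
Qed.

Lemma smooth_approx (u0 : R -> R) (u : R -> R -> R) (H e : R) :
  u0 \in L2 R -> ILW_solution delta u0 u -> L2_continuous setT u -> 0 < H -> 0 < e ->
  exists phi v, smooth_ILW_solution delta phi v /\
    forall t, - H <= t <= H -> (L2norm (v t \- u t)%R <= e%:E)%E.
Proof.
move=> u0L hsol [uL _] H0 e0.
have [S [S1 S2 S3] uS] := hsol H H0.
have [d d0 hd] := S2 u0 u0L e e0.
have d2 : 0 < d / 2 by rewrite divr_gt0.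
have [_ /(_ _ d2)[phi Hphi pu]] := Hinfty_dense u0L.
have phiL : phi \in L2 R by exact: (Hphi 0%N).2.
have [v hv Sv] := S3 phi Hphi.
exists phi, v; split => // t tH.
have tI : t \in `[- H, H] by rewrite in_itv.
have := hd phi phiL; rewrite (le_lt_trans pu) ?lte_fin; last by lra.
move=> /(_ isT t tI); congr (_ <= _)%E.
apply: L2norm_ae_sub.
- exact: Sv.
- by apply: ae_imply_all (uS t tI) => x h y; rewrite h.
- by have [h _] := S1 phi phiL; exact: h.
- exact: (smooth_L2 hv 0).
- by have [h _] := S1 u0 u0L; exact: h.
- exact: uL.
Qed.

Lemma ball_itv (c r : R) : ball c r = `]c - r, c + r[%classic.
Proof.
apply/seteqP; split => x; rewrite /ball/= in_itv/= ltr_norml => /andP[h1 h2];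
  by apply/andP; split; lra.
Qed.

(** From b^2 <= 2 a^2 + 2 (a - b)^2, which avoids the triangle inequality on a
    ball. *)
Lemma local_mass (f g : R -> R) (c r p q kap e : R) :
  f \in L2 R -> continuous g -> 0 <= e -> (L2norm (g \- f)%R <= e%:E)%E ->
  p <= c - r -> c + r <= q ->
  (kap%:E <= \int[mu]_(x in ball c r) (f x ^+ 2)%:E)%E ->
  kap <= 2 * \int[mu]_(x in `[p, q]) (g x ^+ 2) + 2 * e ^+ 2.
Proof.
move=> /L2_measurable mf cg e0 ge pc cq hk.
have mg : measurable_fun setT g by exact: continuous_measurable_fun.
have mI : measurable (`[p, q]%classic : set (measurableTypeR R)) by exact: measurable_itv.
have m2 (h : R -> R) : measurable_fun setT h -> measurable_fun (`[p, q]%classic : set (measurableTypeR R)) (fun x => (h x ^+ 2)%:E).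
  move=> mh; apply: (measurable_funS measurableT (@subsetT _ _)).
  by apply/measurable_EFinP; exact: measurable_funX.
rewrite -lee_fin; apply: (le_trans hk).
apply: (@le_trans _ _ (\int[mu]_(x in `[p, q]) (f x ^+ 2)%:E)%E).
  apply: ge0_subset_integral => //.
  - exact: measurable_ball.
  - exact: m2.
  - by move=> x _; rewrite lee_fin sqr_ge0.
  - rewrite ball_itv => x /=; rewrite !in_itv/= => /andP[h1 h2].
    by apply/andP; split; lra.
have sq (a b : R) : b ^+ 2 <= 2 * a ^+ 2 + 2 * (a - b) ^+ 2.
  rewrite -subr_ge0 (_ : _ - _ = (2 * a - b) ^+ 2) ?sqr_ge0//; ring.
have mgf : measurable_fun setT (g \- f)%R by exact: measurable_funB.
apply: (@le_trans _ _ (\int[mu]_(x in `[p, q]) ((2%:E * (g x ^+ 2)%:E) + 2%:E * ((g \- f)%R x ^+ 2)%:E))%E).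
  apply: ge0_le_integral => //.
  - by move=> x _; rewrite lee_fin sqr_ge0.
  - exact: m2.
  - apply: emeasurable_funD; apply: measurable_funeM; exact: m2.
  - by move=> x _; rewrite -!EFinM -EFinD lee_fin; exact: sq.
rewrite ge0_integralD//; first last.
- by apply: measurable_funeM; exact: m2.
- by move=> x _; rewrite mule_ge0// lee_fin sqr_ge0.
- by apply: measurable_funeM; exact: m2.
- by move=> x _; rewrite mule_ge0// lee_fin sqr_ge0.
rewrite !ge0_integralZl_EFin//; last first.
- exact: m2.
- by move=> x _; rewrite lee_fin sqr_ge0.
- exact: m2.
- by move=> x _; rewrite lee_fin sqr_ge0.
rewrite [leRHS]EFinD; apply: leeD.
  by rewrite EFinM EFin_Rintegral//; exact: (continuous_mul cg cg).
rewrite [leRHS]EFinM; apply: lee_pmul => //.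
  by apply: integral_ge0 => x _; rewrite lee_fin sqr_ge0.
exact: L2norm_integral.
Qed.

End Interval.

(** * The local mass has no positive lower bound *)

Section Final.
Context {R : realType}.
Notation mu := (@lebesgue_measure R).

Lemma powR_unbounded (eps A t0 : R) : 0 < eps ->
  exists T : R, [/\ 1 <= T, t0 < T & A < T `^ eps].
Proof.
move=> e0; pose X := (`|A| + 2) `^ eps^-1.
have X0 : 0 <= X by exact: powR_ge0.
exists (X + `|t0| + 1); split.
- by rewrite lerDr addr_ge0.
- by have := ler_norm t0; lra.
apply: (@lt_le_trans _ _ (X `^ eps)).
  rewrite /X -powRrM mulVf ?gt_eqF// powRr1 ?addr_ge0//.
  by have := ler_norm A; lra.
apply: ge0_ler_powR; rewrite ?nnegrE ?(ltW e0)//.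
- by rewrite !addr_ge0.
- by have := normr_ge0 t0; lra.
Qed.

(** As m <= 1, (t / T)^m <= t / T, so the drift is at most T^m (t - T) / T. *)
Lemma powR_center_drift (b m T tau t : R) : 0 <= m -> m <= 1 -> 1 <= T ->
  T <= t <= T + tau -> T `^ m * (tau / T) <= T `^ b ->
  `|t `^ m - T `^ m| <= T `^ b.
Proof.
move=> m0 m1 T1 /andP[Tt tT] h.
have T0 : 0 < T by lra.
have le1 : T `^ m <= t `^ m.
  by apply: ge0_ler_powR; rewrite ?nnegrE//; lra.
rewrite ger0_norm ?subr_ge0//; apply: le_trans h.
have s1 : 1 <= t / T by rewrite ler_pdivlMr// mul1r.
have -> : t `^ m = T `^ m * (t / T) `^ m.
  by rewrite -powRM ?(ltW T0)//; [congr (_ `^ _); field; rewrite gt_eqF|lra].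
apply: (@le_trans _ _ (T `^ m * (t / T) - T `^ m)).
  by rewrite lerD2r ler_wpM2l ?powR_ge0// ler1_powR.
rewrite -[X in _ - X]mulr1 -mulrBr ler_wpM2l ?powR_ge0//.
rewrite ler_pdivlMr// mulrBl mulfVK ?gt_eqF// mul1r; lra.
Qed.

Lemma powR_double_le (b T t : R) : 0 < b -> b <= 1 -> 1 <= T -> 0 <= t <= 2 * T ->
  t `^ b <= 2 * T `^ b.
Proof.
move=> b0 b1 T1 /andP[t0 t2].
apply: (@le_trans _ _ ((2 * T) `^ b)).
  by apply: ge0_ler_powR; rewrite ?nnegrE//; lra.
rewrite powRM//; last by lra.
by rewrite ler_wpM2r ?powR_ge0// ler1_powR// ler1n.
Qed.

Lemma sqrt_powR_le (T q : R) : 0 < T -> Num.sqrt (2 * (6 * T `^ q)) <= 4 * T `^ (q / 2).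
Proof.
move=> T0.
have p0 := powR_ge0 T (q / 2).
have -> : T `^ q = T `^ (q / 2) ^+ 2.
  by rewrite -powR_mulrn// -powRrM; congr (_ `^ _); field.
rewrite -[leRHS]ger0_norm ?mulr_ge0// -sqrtr_sqr ler_sqrt; last by rewrite sqr_ge0.
by nra.
Qed.

(** The choice of the scales.  Writing P e for T^e, the window has length
    P (th + b), the narrow scale is 6 P b and the wide one 6 P q.  After
    division by P th, each error term carries one of the powers P (b - q),
    P (- 3 b / 2) and P (q / 2 - th), all of which are at most P (- eps). *)
Lemma local_mass_not_bounded_below (delta : R) (u0 : R -> R) (u : R -> R -> R) (b m kap t0 : R) :
  0 < delta -> u0 \in L2 R -> ILW_solution delta u0 u ->
  L2_continuous setT u -> L2_bounded u ->
  0 < b -> b < 2 / 3 -> 0 <= m -> m < 1 - 3 / 2 * b -> 0 < kap ->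
  (forall t, t0 < t ->
    (kap%:E <= \int[mu]_(x in ball (t `^ m)%R (t `^ b)%R) (u t x ^+ 2)%:E)%E) -> False.
Proof.
move=> delta0 u0L hsol uc ub b0 b23 m0 mb kap0 hk.
have [M M0 uM] := L2_bounded_all uc ub.
pose N := M + 1; have N0 : 0 < N by rewrite addr_gt0.
(* th <= 1 - m keeps the drift of the centre below T^b, and th <= 1 - b keeps
   the window inside [T, 2T]. *)
pose th := 1 - Num.max m b.
have th1 : b / 2 < th.
  by rewrite /th; case: (leP m b) => _; lra.
have thm : th <= 1 - m by rewrite /th lerD2l lerN2 le_max lexx.
have thb : th <= 1 - b by rewrite /th lerD2l lerN2 le_max lexx orbT.
(* The wide scale must satisfy q > b and q / 2 < th.  The gains q - b and
   th - q / 2 are th - b / 2 and half of it; the gain of the dispersive term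
   is 3 b / 2.  eps is the least of the three. *)
pose q := b / 2 + th.
pose eps := Num.min ((th - b / 2) / 2) (3 / 2 * b).
have eps0 : 0 < eps by rewrite lt_min; apply/andP; split; lra.
have eps1 : eps <= (th - b / 2) / 2 by rewrite ge_min lexx.
have eps2 : eps <= 3 / 2 * b by rewrite ge_min lexx orbT.
pose kd := kernel_mass delta / delta.
have kd0 : 0 < kd by rewrite divr_gt0// kernel_mass_gt0.
(* C0 collects the constants of the three error terms, and k1 is that of the
   main term: 1/2 from the virial identity, 1/6 from the scale, kap / 4 from
   the approximation and 27/64 from the slope. *)
pose C0 := N ^+ 2 / 12 + 2 * N * kd + 16 * N.
pose k1 := 27 / 64 * kap / 48.
have k10 : 0 < k1.
  by rewrite /k1; apply: divr_gt0 => //; apply: mulr_gt0 => //; apply: divr_gt0.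
have [T [T1 Tt0 TA]] := powR_unbounded (C0 / k1) t0 eps0.
have T0 : 0 < T by lra.
pose P e := T `^ e.
have P0 e : 0 < P e by exact: powR_gt0.
have PD e1 e2 : P (e1 + e2) = P e1 * P e2.
  by rewrite /P powRD// (gt_eqF T0) implybT.
have Ple e1 e2 : e1 <= e2 -> P e1 <= P e2 by move=> h; exact: ler_powR.
(* The distance to the smooth solution: e <= 1 bounds its norm by M + 1, and
   e^2 <= kap / 4 leaves it a local mass of at least kap / 4. *)
pose e := Num.min 1 (Num.sqrt kap / 2).
have e0 : 0 < e by rewrite lt_min ltr01 divr_gt0// sqrtr_gt0.
have e1 : e <= 1 by rewrite ge_min lexx.
have e2 : e ^+ 2 <= kap / 4.
  have : e <= Num.sqrt kap / 2 by rewrite ge_min lexx orbT.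
  move=> h; have := ler_pM (ltW e0) (ltW e0) h h.
  rewrite -!expr2 => /le_trans; apply.
  by rewrite expr_div_n sqr_sqrtr ?(ltW kap0)// -natrX.
pose tau := P (th + b).
have tauT : tau <= T.
  by rewrite /tau /P -[leRHS]powRr1 ?(ltW T0)//; apply: ler_powR => //; lra.
have T20 : 0 < 2 * T by rewrite mulr_gt0.
have [phi [v [hv vu]]] := smooth_approx u0L hsol uc T20 e0.
have tH t : T <= t <= T + tau -> - (2 * T) <= t <= 2 * T.
  by move=> /andP[h1 h2]; apply/andP; split; lra.
have uL t : u t \in L2 R by have [h _] := uc; exact: h.
have vc t : continuous (v t) by exact: (smooth_continuous hv (k := 0) (t := t)).
have vN t : T <= t <= T + tau -> (L2norm (v t) <= N%:E)%E.
  move=> tT; apply: (@L2norm_le_near _ (v t) (u t) M 1) => //.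
  - exact: continuous_measurable_fun.
  - exact: L2_measurable.
  - by apply: le_trans (vu t (tH t tT)) _; rewrite lee_fin.
(* The interval of length 6 P b has to contain balls of radius 2 P b whose
   centre is within P b of P m. *)
pose lam := 6 * P b; pose lam1 := 6 * P q.
have lam0 : 0 < lam by rewrite mulr_gt0.
have lam01 : lam <= lam1 by rewrite ler_pM2l//; apply: Ple; rewrite /q; lra.
have vk t : T <= t <= T + tau ->
   kap / 4 <= \int[mu]_(x in `[P m - lam / 2, P m + lam / 2]) (v t x ^+ 2).
  move=> tT; have /andP[Tt tTt] := tT.
  have hc : `|t `^ m - P m| <= P b.
    apply: (@powR_center_drift b m T tau) => //; first by lra.
    rewrite -[T `^ m]/(P m) -[T `^ b]/(P b).
    have -> : P m * (tau / T) = P (m + (th + b) - 1).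
      have hT : P (-1) = T^-1 by rewrite /P powR_inv1// ltW.
      by rewrite /tau !PD hT; ring.
    by apply: Ple; lra.
  have hr : t `^ b <= 2 * P b.
    by apply: powR_double_le => //; [lra|apply/andP; split; lra].
  move: hc; rewrite ler_norml => /andP[hc1 hc2].
  have t0t : t0 < t by lra.
  have := @local_mass R (u t) (v t) (t `^ m) (t `^ b) (P m - lam / 2) (P m + lam / 2) kap e
    (uL t) (vc t) (ltW e0) (vu t (tH t tT)).
  rewrite /lam => H; have : kap <= 2 * \int[mu]_(x in `[P m - 6 * P b / 2, P m + 6 * P b / 2]) (v t x ^+ 2) + 2 * e ^+ 2.
    by apply: H; [lra|lra|exact: hk].
  by lra.
(* Both scales contribute to B; the wide one contributes less. *)
pose B := 2 * N * P (- (5 / 2 * b)).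
have hB : 30 * lam^-1 ^+ 3 * (Num.sqrt (2 * lam) * N) +
    30 * lam1^-1 ^+ 3 * (Num.sqrt (2 * lam1) * N) <= B.
  have hs s : 30 * (6 * P s)^-1 ^+ 3 * (Num.sqrt (2 * (6 * P s)) * N) <= N * P (- (5 / 2 * s)).
    have hq := sqrt_powR_le s T0; rewrite -/(P s) -/(P (s / 2)) in hq.
    apply: (@le_trans _ _ (30 * (6 * P s)^-1 ^+ 3 * (4 * P (s / 2) * N))).
      have c0 : 0 <= 30 * (6 * P s)^-1 ^+ 3.
        apply: mulr_ge0 => //; apply: exprn_ge0; rewrite invr_ge0.
        by apply: mulr_ge0 => //; exact: ltW.
      have N0' := ltW N0.
      by apply: (ler_wpM2l c0); apply: (ler_wpM2r N0').
    have -> : P s = P (s / 2) ^+ 2 by rewrite expr2 -PD -splitr.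
    have -> : P (- (5 / 2 * s)) = (P (s / 2) ^+ 5)^-1.
      by rewrite /P -powR_mulrn ?powR_ge0// -powRrM -powRN; congr (_ `^ _); field.
    set z := P (s / 2); have z0 : 0 < z by exact: P0.
    have -> : 30 * (6 * z ^+ 2)^-1 ^+ 3 * (4 * z * N) = 120 / 216 * (N * (z ^+ 5)^-1).
      by field; rewrite gt_eqF.
    rewrite ler_piMl ?mulr_ge0 ?(ltW N0) ?invr_ge0 ?exprn_ge0 ?(ltW z0)//.
    by rewrite ler_pdivrMr// mul1r ler_nat.
  have := hs b; have := hs q; rewrite -/lam -/lam1 => h1 h2.
  have h3 : N * P (- (5 / 2 * q)) <= N * P (- (5 / 2 * b)).
    by rewrite ler_pM2l//; apply: Ple; rewrite /q; lra.
  by rewrite /B; lra.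
have := virial_interval_le delta0 hv lam0 lam01 (P0 (th + b)) N0 vN vk hB.
have hq := sqrt_powR_le q T0; rewrite -/(P q) -/lam1 in hq.
have Z1 : P (b - q) <= P (- eps) by apply: Ple; rewrite /q; lra.
have Z2 : P (- (3 / 2 * b)) <= P (- eps) by apply: Ple; lra.
have Z3 : P (q / 2 - th) <= P (- eps) by apply: Ple; rewrite /q; lra.
have E1 : P (th + b) = P th * P b by rewrite PD.
have E2 : P q = P b / P (b - q) by rewrite PD /P powRN; field; rewrite !gt_eqF ?powR_gt0.
have E3 : P (- (5 / 2 * b)) = P (- (3 / 2 * b)) / P b.
  rewrite (_ : - (5 / 2 * b) = - (3 / 2 * b) + - b); last by field.
  by rewrite PD /P powRN.
have E4 : P (q / 2) = P th * P (q / 2 - th) by rewrite -PD; congr P; ring.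
rewrite -/(P q) -/(P (q / 2)) in hq.
move=> H.
have {}H : P th * (k1 - N ^+ 2 / 12 * P (b - q) - 2 * N * kd * P (- (3 / 2 * b)))
    <= P th * (16 * N * P (q / 2 - th)).
  apply: le_trans (le_trans H _).
    rewrite le_eqVlt; apply/orP; left; apply/eqP.
    rewrite E1 /lam1 E2 /B E3 /lam /k1 /kd; field.
    by rewrite !gt_eqF.
  have -> : P th * (16 * N * P (q / 2 - th)) = 4 * (4 * P (q / 2) * N) by rewrite E4; ring.
  by rewrite ler_pM2l// ler_pM2r.
rewrite ler_pM2l// in H.
have ZA : P (- eps) * C0 < k1.
  rewrite /P powRN mulrC ltr_pdivrMr ?powR_gt0// mulrC.
  by rewrite -ltr_pdivrMr.
have n1 : N ^+ 2 / 12 * P (b - q) <= N ^+ 2 / 12 * P (- eps).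
  by rewrite ler_pM2l// divr_gt0// exprn_gt0.
have n2 : 2 * N * kd * P (- (3 / 2 * b)) <= 2 * N * kd * P (- eps).
  by apply: ler_wpM2l Z2; rewrite mulr_ge0 ?(ltW kd0)// mulr_ge0// ltW.
have n3 : 16 * N * P (q / 2 - th) <= 16 * N * P (- eps).
  by rewrite ler_pM2l// mulr_gt0.
have : P (- eps) * C0 = N ^+ 2 / 12 * P (- eps) + 2 * N * kd * P (- eps) + 16 * N * P (- eps).
  by rewrite /C0; ring.
lra.
Qed.

End Final.

Theorem corollary1p5 (R : realType) (delta : R) (hdelta : 0 < delta)
    (u0 : R -> R) (hu0 : u0 \in L2 R)
    (u : R -> R -> R) (hsol : ILW_solution delta u0 u)
    (hinit : u 0 = u0 %[ae @lebesgue_measure R])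
    (hcont : L2_continuous setT u) (hbound : L2_bounded u)
    (b m : R) (hb0 : 0 < b) (hb : b < 2 / 3)
    (hm0 : 0 <= m) (hm : m < 1 - 3 / 2 * b) :
  limf_einf
    (fun t : R => (\int[@lebesgue_measure R]_(x in ball (t `^ m)%R (t `^ b)%R)
                     (u t x ^+ 2)%R%:E)%E)
    (pinfty_nbhs R) = 0%E.
Proof.
rewrite limf_einfE; apply/eqP; rewrite eq_le; apply/andP; split.
  apply: ge_ereal_sup => _ [V [A [Ar hV]] <-].
  rewrite leNgt; apply/negP => h.
  have [kap kap0 hkap] : exists2 kap : R, 0 < kap &
     (kap%:E <= ereal_inf [set (\int[@lebesgue_measure R]_(x in ball (t `^ m)%R (t `^ b)%R)
                     (u t x ^+ 2)%R%:E)%E | t in V])%E.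
    move: h; case: (ereal_inf _) => [r| |] //=.
      by rewrite lte_fin => r0; exists r.
    by move=> _; exists 1 => //; rewrite leey.
  apply: (@local_mass_not_bounded_below R delta u0 u b m kap A) => // t At.
  apply: (le_trans hkap); apply: ereal_inf_lbound => /=; exists t => //; exact: hV.
set I := (fun t : R => _).
have I0 : (0 <= ereal_inf (I @` setT))%E.
  apply: le_ereal_inf_tmp => _ [t _ <-].
  by apply: integral_ge0 => x _; rewrite lee_fin sqr_ge0.
apply: (le_trans I0); apply: ereal_sup_ubound => /=; exists setT => //; exact: filterT.
Qed.
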